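(* Let $\alpha=(A_+,A_-,D)$ be a Cartan-like T-datum of finite type of size $r$, with $D=\mathrm{diag}(d_1,\dots,d_r)$. Let $\mathring{A}_\pm=A_\pm|_{z=1}$ (these matrices are invertible), $K=\mathring{A}_+^{-1}\mathring{A}_-$, and $K^\vee=(\check\kappa_{ab})_{a,b\in[1,r]}=D^{-1}KD$. (1) The system of equations $$f_a=\prod_{b=1}^r(1-f_b)^{\check\kappa_{ab}}\qquad(a\in[1,r])$$ has a unique real solution such that $0<f_a<1$ for any $a\in[1,r]$. (2) Let $(f_a)_{a\in[1,r]}$ be the unique solution in (1), and define the real number $$c_\alpha:=\frac{6}{\pi^2}\sum_{a=1}^rd_aL(f_a).$$ Then $c_\alpha\in\mathbb{Q}$.
   Context: Notation: $[1,r]=\{1,\dots,r\}$; $\mathfrak{S}_r$ is the group of permutations of $[1,r]$; $\delta$ is the Kronecker delta. For a square matrix $A$ with entries in $\mathbb{Z}[z^{\pm1}]$, $A^\dagger:=(A|_{z=z^{-1}})^{\mathsf T}$. T-datum: consider triples $(N_0,N_+,N_-)$ of matrices in $\mathrm{Mat}_{r\times r}(\mathbb{Z}[z])$, $N_\varepsilon=(\sum_{p\ge0}n^\varepsilon_{ab;p}z^p)_{a,b\in[1,r]}$, satisfying (N1) $n^0_{ab;p}=\delta_{ab}\delta_{p0}+\delta_{a\sigma(b)}\delta_{pp_a}$ for some $\sigma\in\mathfrak{S}_r$ and $p_a\in\mathbb{Z}_{>0}$; (N2) $n^\pm_{ab;p}\ge0$ for all $a,b,p$; (N3) $n^\pm_{ab;p}=0$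 unless $0<p<p_a$; (N4) $n^+_{ab;p}n^-_{ab;p}=0$ for all $a,b,p$. A T-datum of size $r$ is a triple $\alpha=(A_+,A_-,D)$ such that $A_\pm=N_0-N_\pm$ for some $(N_0,N_+,N_-)$ satisfying (N1)-(N4) (this triple is uniquely determined by $(A_+,A_-)$) and $D$ is a positive integer diagonal matrix with $N_0D=DN_0$, $D^{-1}N_\pm D\in\mathrm{Mat}_{r\times r}(\mathbb{Z}[z])$, and $A_+DA_-^\dagger=A_-DA_+^\dagger$. Cartan-like: with $P=\mathrm{diag}(z^{-p_a/2})_{a\in[1,r]}$, $\alpha$ is Cartan-like if both $PA_+$ and $PA_-$ are invariant under $z\mapsto z^{-1}$ (entries in $\mathbb{Z}[z^{\pm1/2}]$, $z^{1/2}\mapsto z^{-1/2}$). Finite type: let $\mathscr{T}(\alpha)$ be the commutative ring generated by indeterminates $T_a(u)^{\pm1}$, $(a,u)\in[1,r]\times\mathbb{Z}$, subject to $T_a(u)T_a(u)^{-1}=1$ and, for all $(a,u)$, $$\prod_{b=1}^{r}\prod_{p\ge0}T_b(u+p)^{n^0_{ba;p}}=\prod_{b=1}^{r}\prod_{p\ge0}T_b(u+p)^{n^+_{ba;p}}+\prod_{b=1}^{r}\prod_{p\ge0}T_b(u+p)^{n^-_{ba;p}}.$$ $\alpha$ is of finite type if the set of all $T_a(u)\in\mathscr{T}(\alpha)$, $(a,u)\in[1,r]\times\mathbb{Z}$, is finite. Rogers dilogarithm: $L(x)=\mathrm{Li}_2(x)+\frac12\log(x)\log(1-x)$ for $0<x<1$,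 where $\mathrm{Li}_2(x)=\sum_{n\ge1}x^n/n^2$. *)

(* Defs.v *)
From mathcomp Require Import all_boot all_order all_algebra perm.
From mathcomp Require Import all_classical all_reals all_analysis.
(* The notations of monalg clash with those of mathcomp-analysis. *)
From mathcomp.multinomials Require Import -(notations) monalg.

Set Implicit Arguments.
Unset Strict Implicit.
Unset Printing Implicit Defensive.

Import Order.TTheory GRing.Theory Num.Theory.
Import numFieldNormedType.Exports.
Local Open Scope classical_set_scope.
Local Open Scope ring_scope.

(* The index set [1,r] is rendered by 'I_r = {0, ..., r-1}.

   Identities between Laurent polynomials in an indeterminate x are stated in
   the fraction field of Z[x], which contains Z[x^{+-1}]; x^{-1} is then a
   genuine element, and replacing x by x^{-1} is evaluation at x^{-1}.
   The indeterminate [zL] plays the role of z in [Tdatum] and of z^{1/2} in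
   [Cartan_like]. *)
Definition Laurent : fieldType := {fraction {poly int}}.

Definition zL : Laurent := FracField.tofrac ('X : {poly int}).

Definition peval (F : fieldType) (x : F) (q : {poly int}) : F :=
  (map_poly (intr : int -> F) q).[x].

Definition mxeval (F : fieldType) m n (x : F) (A : 'M[{poly int}]_(m, n)) :
  'M[F]_(m, n) := map_mx (peval x) A.

Definition dagger r (A : 'M[{poly int}]_r) : 'M[Laurent]_r :=
  (mxeval zL^-1 A)^T.

Definition intdiag (S : nzRingType) r (d : 'rV[int]_r) : 'M[S]_r :=
  diag_mx (map_mx intr d).

(* A_+ and A_- are N_0 - N_+ and N_0 - N_- (see [Aplus], [Aminus]).  By
   (N1)-(N4) the pair (A_+, A_-) determines N_0, N_+, N_-, sigma and (p_a), so
   carrying the latter as fields does not add any freedom. *)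
Structure Tdatum (r : nat) := MkTdatum {
  N0 : 'M[{poly int}]_r;
  Nplus : 'M[{poly int}]_r;
  Nminus : 'M[{poly int}]_r;
  tsigma : 'S_r;
  tp : 'I_r -> nat;
  td : 'rV[int]_r;
  (* (N1) *)
  tp_gt0 : forall a, (0 < tp a)%N;
  N0E : forall a b (k : nat), (N0 a b)`_k =
    ((a == b) && (k == 0%N))%:R + ((a == tsigma b) && (k == tp a))%:R;
  (* (N2) *)
  Nplus_ge0 : forall a b (k : nat), 0 <= (Nplus a b)`_k;
  Nminus_ge0 : forall a b (k : nat), 0 <= (Nminus a b)`_k;
  (* (N3) *)
  Nplus_supp : forall a b (k : nat),
    ~~ (0 < k < tp a)%N -> (Nplus a b)`_k = 0;
  Nminus_supp : forall a b (k : nat),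
    ~~ (0 < k < tp a)%N -> (Nminus a b)`_k = 0;
  (* (N4) *)
  Nplus_Nminus : forall a b (k : nat), (Nplus a b)`_k * (Nminus a b)`_k = 0;
  (* the conditions on D *)
  td_gt0 : forall a, 0 < td 0 a;
  N0_D : N0 *m intdiag _ td = intdiag _ td *m N0;
  Nplus_D : exists M : 'M[{poly int}]_r,
    invmx (intdiag _ td) *m mxeval zL Nplus *m intdiag _ td = mxeval zL M;
  Nminus_D : exists M : 'M[{poly int}]_r,
    invmx (intdiag _ td) *m mxeval zL Nminus *m intdiag _ td = mxeval zL M;
  symplectic_D :
    mxeval zL (N0 - Nplus) *m intdiag _ td *m dagger (N0 - Nminus) =
    mxeval zL (N0 - Nminus) *m intdiag _ td *m dagger (N0 - Nplus)
}.

Section Tdatum_theory.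

Variables (r : nat) (alpha : Tdatum r).

Definition Aplus : 'M[{poly int}]_r := N0 alpha - Nplus alpha.

Definition Aminus : 'M[{poly int}]_r := N0 alpha - Nminus alpha.

(* The matrix P A, as a function of the value w of z^{1/2}. *)
Definition PA (w : Laurent) (A : 'M[{poly int}]_r) : 'M[Laurent]_r :=
  diag_mx (\row_a w ^- tp alpha a) *m mxeval (w ^+ 2) A.

Definition Cartan_like : Prop :=
  PA zL^-1 Aplus = PA zL Aplus /\ PA zL^-1 Aminus = PA zL Aminus.

(* The ring T(alpha) is the quotient of the polynomial ring over Z in the
   indeterminates indexed by ('I_r * int) * bool, where (a, u, true) stands for
   T_a(u) and (a, u, false) for T_a(u)^{-1}, by the ideal generated by the
   defining relations.  Its elements are the cosets of this ideal. *)
Definition Tindex : choiceType := ('I_r * int * bool)%type.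

Definition Tfree : comNzRingType := malg (cmonom Tindex) int.

Definition Tvar (a : 'I_r) (u : int) : Tfree := mkmalgU (@ucm Tindex (a, u, true)) 1.

Definition Tvar_inv (a : 'I_r) (u : int) : Tfree := mkmalgU (@ucm Tindex (a, u, false)) 1.

(* The entries of N_0, N_+, N_- have nonnegative coefficients, so the absolute
   value below only converts the exponent to a natural number. *)
Definition Tprod (N : 'M[{poly int}]_r) (a : 'I_r) (u : int) : Tfree :=
  \prod_(b < r) \prod_(k < size (N b a))
    Tvar b (u + (k : nat)%:Z) ^+ absz ((N b a)`_k).

Definition Trel : set Tfree := [set x | exists (a : 'I_r) (u : int),
  x = Tvar a u * Tvar_inv a u - 1 \/
  x = Tprod (N0 alpha) a u -
      (Tprod (Nplus alpha) a u + Tprod (Nminus alpha) a u)].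

Definition ideal_closed (I : set Tfree) : Prop :=
  [/\ I 0, forall x y, I x -> I y -> I (x + y) & forall x y, I y -> I (x * y)].

Definition Tideal : set Tfree := smallest ideal_closed Trel.

Definition Tcoset (x : Tfree) : set Tfree := [set y | Tideal (y - x)].

Definition finite_type : Prop :=
  finite_set [set Tcoset (Tvar au.1 au.2) | au in [set: 'I_r * int]].

Definition Aplus1 : 'M[rat]_r := mxeval 1 Aplus.

Definition Aminus1 : 'M[rat]_r := mxeval 1 Aminus.

Definition Kmx : 'M[rat]_r := invmx Aplus1 *m Aminus1.

Definition Kcheck : 'M[rat]_r :=
  invmx (intdiag _ (td alpha)) *m Kmx *m intdiag _ (td alpha).

Definition Nahm_solution (R : realType) (f : 'rV[R]_r) : Prop :=
  (forall a, 0 < f 0 a < 1) /\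
  (forall a, f 0 a = \prod_(b < r) (1 - f 0 b) `^ ratr (Kcheck a b)).

End Tdatum_theory.

Definition Li2 (R : realType) (x : R) : R :=
  \big[+%R/0]_(1 <= n <oo) (x ^+ n / n%:R ^+ 2).

(* Only used for 0 < x < 1. *)
Definition Rogers_L (R : realType) (x : R) : R :=
  Li2 x + 2^-1 * ln x * ln (1 - x).

Definition c_alpha (R : realType) r (alpha : Tdatum r) (f : 'rV[R]_r) : R :=
  6 / pi ^+ 2 * \sum_(a < r) (td alpha 0 a)%:~R * Rogers_L (f 0 a).

(* Main.v *)
(* Work with t_a(u) = log T_a(u) along real positive solutions of the T-system.  Such a
   solution is determined by an arbitrary window (t_a(u + k), k < p_a), and each one is a
   ring homomorphism from T(alpha) to R, so finite type makes all of them periodic with a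
   common period Om.

   Positivity.  For a Cartan-like T-datum sigma = id, so A_+ and A_- are of the form
   (1 + z^p_a) - (nonnegative).  Take the solution with vanishing initial window and put
   L_a(y) = sum_(u < Om) t_a(u) y^u.  Since the boundary terms of a shift vanish, the
   vector L(y) A_(+-)(1/y) is the generating function of log(1 + Y^(-+1)) > 0.  As
   L_a(y) > 0 for small y, a first zero of min_a L_a is impossible, whence l = L(1) > 0
   and l A_(+-)(1) > 0.  The maximum principle for delta_a / l_a then gives the invertibility
   of A_(+-)(1) and the uniqueness of constant solutions of the T-system; a constant
   solution exists between 0 and a multiple of l by the Knaster-Tarski argument.  Through
   the symplectic relation at z = 1, constant solutions are the solutions of the
   system f_a = prod (1 - f_b)^kappa_ab.

   Rationality.  With G(y) = L(1 / (1 + e^y)) one has 2 dG = M dP - P dM, where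
   P = log(1 + e^-y) and M = log(1 + e^y) are the linear functions A_+ t and A_- t of a
   solution; the symplectic relation makes sum_(a, u < Om) d_a G(y_a(u)) independent of
   the solution.  It is evaluated at the constant solution and along a ray to infinity
   whose direction consists of logarithms of distinct primes.  The limit is governed by the
   tropical (max-plus) T-system, whose steps are unimodular, so that no tropical y_a(u)
   vanishes unless the corresponding columns of N_+ and N_- do: every G(y_a(u)) tends to
   0, pi^2/12 or pi^2/6. *)
From HB Require Import structures.
Require Import Defs.
From mathcomp Require Import all_boot all_order all_algebra perm.
From mathcomp Require Import finmap.
From mathcomp Require Import all_classical all_reals all_analysis.
From mathcomp.multinomials Require Import -(notations) monalg.
From mathcomp Require Import zify ring lra.

Set Implicit Arguments.
Unset Strict Implicit.
Unset Printing Implicit Defensive.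

Import Order.TTheory GRing.Theory Num.Theory.
Import numFieldNormedType.Exports.
Local Open Scope classical_set_scope.
Local Open Scope ring_scope.

(** * Evaluating the ring of the T-system *)

Section MonomialEvaluation.
Variables (I : choiceType) (S : comNzRingType) (v : I -> S).

Definition mon_eval (m : cmonom I) : S := \prod_(i <- finsupp m) v i ^+ m i.

Lemma mon_evalE (d : {fset I}) (m : cmonom I) : (finsupp m `<=` d)%fset ->
  mon_eval m = \prod_(i <- d) v i ^+ m i.
Proof.
move=> le; rewrite /mon_eval; apply: big_fset_incl => // i _.
by rewrite -cmE_eq0 => /eqP ->; rewrite expr0.
Qed.

Lemma mon_eval_is_mmorphism : mmorphism mon_eval.
Proof.
split=> [m1 m2|]; last by rewrite /mon_eval mdom1 big_seq_fset0.
rewrite (mon_evalE (fsubsetUl (finsupp m1) (finsupp m2))).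
rewrite (mon_evalE (fsubsetUr (finsupp m1) (finsupp m2))).
rewrite /mon_eval mdomD -big_split /=; apply: eq_bigr => i _.
by rewrite cmM exprD.
Qed.

HB.instance Definition _ := isMultiplicative.Build (cmonom I) S mon_eval
  mon_eval_is_mmorphism.

Definition malg_eval : malg (cmonom I) int -> S := mmap intr mon_eval.

Lemma malg_evalD : {morph malg_eval : x y / x + y}.
Proof. exact: mmapD. Qed.

Lemma malg_evalB : {morph malg_eval : x y / x - y}.
Proof. exact: mmapB. Qed.

Lemma malg_evalM : {morph malg_eval : x y / x * y}.
Proof. by case: (@mmap_is_multiplicative (cmonom I) int S intr mon_eval). Qed.

Lemma malg_eval1 : malg_eval 1 = 1.
Proof. by case: (@mmap_is_multiplicative (cmonom I) int S intr mon_eval). Qed.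

Lemma malg_eval0 : malg_eval 0 = 0.
Proof. exact: mmap0. Qed.

Lemma malg_evalU i : malg_eval (mkmalgU (@ucm I i) 1) = v i.
Proof.
by rewrite /malg_eval mmapU /mon_eval mdomU big_seq_fset1 cmUU expr1 mul1r.
Qed.

End MonomialEvaluation.

(** Pigeonhole on the functions i |-> f i u: they take values in a finite set of functions because I
    is finite, so the collision is simultaneous in i. *)
Lemma finite_range_collision (I : finType) (T : choiceType) (f : I -> nat -> T) :
  finite_set [set f iu.1 iu.2 | iu in [set: I * nat]] ->
  exists u0 u1 : nat, (u0 < u1)%N /\ forall i, f i u0 = f i u1.
Proof.
move=> /finite_fsetP [X EX].
have fX i u : f i u \in X.
  by have: [set` X] (f i u) by rewrite -EX; exists (i, u).
pose g (u : 'I_(#|{ffun I -> X}|.+1)) : {ffun I -> X} := [ffun i => [` fX i u]%fset].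
have: ~ injective g.
  by move=> /leq_card; rewrite card_ord ltnn.
move=> /existsNP [u] /existsNP [w] /not_implyP [guw nuw].
have E i : f i u = f i w.
  by move/ffunP: guw => /(_ i); rewrite !ffunE => /(congr1 val).
have := nuw; case: (ltngtP u w) => [lt|lt|/val_inj //] _.
- by exists u, w.
- by exists w, u; split.
Qed.

(** * Solutions over a field as points of the ring T(alpha) *)

Section FiniteType.
Variables (S : fieldType) (r : nat) (alpha : Tdatum r).

Definition Tmon (T : 'I_r -> int -> S) (N : 'M[{poly int}]_r) a u : S :=
  \prod_(b < r) \prod_(k < size (N b a)) T b (u + (k : nat)%:Z) ^+ absz ((N b a)`_k).

Definition Tsolution (T : 'I_r -> int -> S) := forall a u,
  T a u != 0 /\ Tmon T (N0 alpha) a u = Tmon T (Nplus alpha) a u + Tmon T (Nminus alpha) a u.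

Lemma Tcoset_eval (T : 'I_r -> int -> S) a u w : Tsolution T ->
  Tcoset alpha (Tvar a u) = Tcoset alpha (Tvar a w) -> T a u = T a w.
Proof.
move=> solT E.
pose v (i : Tindex r) := if i.2 then T i.1.1 i.1.2 else (T i.1.1 i.1.2)^-1.
pose ev : Tfree r -> S := malg_eval v.
have evD x y : ev (x + y) = ev x + ev y by exact: malg_evalD.
have evB x y : ev (x - y) = ev x - ev y by exact: malg_evalB.
have evM x y : ev (x * y) = ev x * ev y by exact: malg_evalM.
have ev1 : ev 1 = 1 by exact: malg_eval1.
have evT b x : ev (Tvar b x) = T b x by exact: malg_evalU.
have evV b x : ev (Tvar_inv b x) = (T b x)^-1 by exact: malg_evalU.
have evX x n : ev (x ^+ n) = ev x ^+ n.
  elim: n => [|n IH]; first by rewrite !expr0.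
  by rewrite exprS evM IH -exprS.
have evN N b x : ev (Tprod N b x) = Tmon T N b x.
  rewrite (big_morph ev evM ev1); apply: eq_bigr => c _.
  by rewrite (big_morph ev evM ev1); apply: eq_bigr => k _; rewrite evX evT.
have ker (x : Tfree r) : Tideal alpha x -> ev x = 0.
  suff /(_ x) : Tideal alpha `<=` [set x | ev x = 0] by [].
  apply: (@smallest_sub _ (@ideal_closed r) (Trel alpha)) => [|y].
    split; first exact: (malg_eval0 v).
      by move=> y z y0 z0; rewrite /mkset evD y0 z0 addr0.
    by move=> y z z0; rewrite /mkset evM z0 mulr0.
  have ev_eq y1 y2 : ev y1 = ev y2 -> ev (y1 - y2) = 0 by move=> e; rewrite evB e subrr.
  move=> [b [c bc]]; have [Tn0 eqT] := solT b c; case: bc => ->; apply: ev_eq.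
    refine (etrans _ (esym ev1)); refine (etrans (evM _ _) _).
    exact: etrans (congr2 *%R (evT b c) (evV b c)) (divff Tn0).
  refine (etrans _ (esym (evD _ _))); refine (etrans (evN _ _ _) _).
  exact: etrans eqT (esym (congr2 +%R (evN _ b c) (evN _ b c))).
have Iuw : Tideal alpha (Tvar a u - Tvar a w).
  have: Tcoset alpha (Tvar a u) (Tvar a u).
    by rewrite /Tcoset /mkset subrr => I [[]].
  by rewrite [X in X _]E.
have /eqP := etrans (esym (ker _ Iuw))
  (etrans (evB _ _) (congr2 (fun x y => x - y) (evT a u) (evT a w))).
by rewrite eq_sym subr_eq0 => /eqP.
Qed.

(** The collision happens between cosets, so the same [u0] and [u1] serve all solutions T at
    once. *)
Lemma finite_type_recurrence (W : nat) : finite_type alpha ->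
  exists u0 u1 : nat, (u0 < u1)%N /\ forall T, Tsolution T ->
    forall a (k : 'I_W), T a (u0 + k)%:Z = T a (u1 + k)%:Z.
Proof.
move=> fin.
have [|u0 [u1 [lt01 E]]] := @finite_range_collision ('I_r * 'I_W)%type _
    (fun ak (u : nat) => Tcoset alpha (Tvar ak.1 (u + ak.2)%:Z)).
  apply: sub_finite_set fin => _ [[[a k] u]] _ <- /=.
  by exists (a, (u + k)%:Z).
exists u0, u1; split=> // T solT a k; apply: Tcoset_eval solT _.
exact: (E (a, k)).
Qed.

End FiniteType.

(** * Evolution of the T-system *)

Section Evolution.
Variables (R : realFieldType) (r W : nat) (p : 'I_r -> nat).
Hypothesis p_gt0 : forall a, (0 < p a)%N.

Definition supported (n : 'I_r -> 'I_r -> nat -> nat) :=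
  forall b a k, ~~ (0 < k < p b)%N -> n b a k = 0%N.

(** The logarithm of the monomial of column a, as a linear form in the logarithms. *)
Definition lc (n : 'I_r -> 'I_r -> nat -> nat) (f : 'I_r -> nat -> R) a : R :=
  \sum_(b < r) \sum_(k < W) (n b a k)%:R * f b k.

Lemma eq_lc n f g a : supported n ->
  (forall b k, (0 < k < p b)%N -> f b k = g b k) -> lc n f a = lc n g a.
Proof.
move=> n0 fg; apply: eq_bigr => b _; apply: eq_bigr => k _.
have [/fg ->//|/n0 ->] := boolP (0 < k < p b)%N; by rewrite !mul0r.
Qed.

Variables (np nm : 'I_r -> 'I_r -> nat -> nat) (F : R -> R -> R).
Hypotheses (np0 : supported np) (nm0 : supported nm).

(* A state f holds log T_a(u + k) in f a k; only its window, the entries with k < p a, is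
   determined by the T-system, and the other entries are junk. *)
Definition fwd (f : 'I_r -> nat -> R) (a : 'I_r) (k : nat) : R :=
  if k.+1 == p a then F (lc np f a) (lc nm f a) - f a 0%N else f a k.+1.

(** The T-system is also solvable for its earliest term. The shift [j.-1] places the old window
    after the new entry; at j = 0 it gives a default value, which a supported form never reads. *)
Definition bwd (f : 'I_r -> nat -> R) (a : 'I_r) (k : nat) : R :=
  if k is k'.+1 then f a k'
  else F (lc np (fun b j => f b j.-1) a) (lc nm (fun b j => f b j.-1) a)
       - f a (p a).-1.

Lemma fwd_bwd f a k : (k < p a)%N -> fwd (bwd f) a k = f a k.
Proof.
rewrite /fwd; case: eqP => [Ek _|//].
rewrite (@eq_lc np _ (fun b j => f b j.-1)) // => [|b [|j]//].
rewrite (@eq_lc nm _ (fun b j => f b j.-1)) // => [|b [|j]//].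
by rewrite /= -Ek subKr.
Qed.

Lemma eq_fwd f g : (forall a k, (k < p a)%N -> f a k = g a k) ->
  forall a k, (k < p a)%N -> fwd f a k = fwd g a k.
Proof.
move=> fg a k lk; rewrite /fwd; case: eqP => [_|/eqP nk].
  rewrite (@eq_lc np _ g) ?(@eq_lc nm _ g) ?fg // => b j /andP[_ lj]; exact: fg.
by rewrite fg // ltn_neqAle nk.
Qed.

Lemma eq_iter_fwd f g n : (forall a k, (k < p a)%N -> f a k = g a k) ->
  forall a k, (k < p a)%N -> iter n fwd f a k = iter n fwd g a k.
Proof. by move=> fg; elim: n => //= n IH; apply: eq_fwd. Qed.

(** The relations of T(alpha) run over all integers u, so a real point of that ring needs the
    backward steps as well. *)
Definition statez f (u : int) : 'I_r -> nat -> R :=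
  match u with Posz n => iter n fwd f | Negz n => iter n.+1 bwd f end.

Lemma statezS f u a k : (k < p a)%N ->
  statez f (u + 1) a k = fwd (statez f u) a k.
Proof.
case: u => [n|n] lk; first by rewrite -PoszD addn1.
have -> : Negz n + 1 = - n%:Z by lia.
by case: n => [|n]; rewrite ?oppr0 -?NegzE /= fwd_bwd.
Qed.

Definition solz f a u : R := statez f u a 0%N.

Lemma solzD f a u (k : nat) : (k < p a)%N -> solz f a (u + k%:Z) = statez f u a k.
Proof.
elim: k u => [|k IH] u lk; first by rewrite addr0.
have -> : u + k.+1%:Z = (u + 1) + k%:Z by lia.
by rewrite IH 1?ltnW // statezS 1?ltnW // /fwd ltn_eqF.
Qed.

Lemma solz_system f a u : solz f a u + solz f a (u + (p a)%:Z) =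
  F (lc np (fun b k => solz f b (u + k%:Z)) a)
    (lc nm (fun b k => solz f b (u + k%:Z)) a).
Proof.
rewrite (@eq_lc np _ (statez f u)) // => [|b k /andP[_ lk]]; last exact: solzD.
rewrite (@eq_lc nm _ (statez f u)) // => [|b k /andP[_ lk]]; last exact: solzD.
(* The value at time u + p_a is the last window entry of the state at time u + 1, the one that [fwd]
   computes from the system. *)
have -> : u + (p a)%:Z = (u + 1) + (p a).-1%:Z by have := p_gt0 a; lia.
rewrite solzD ?prednK // statezS ?prednK // /fwd prednK // eqxx.
by rewrite addrC subrK.
Qed.

Definition sol f a (u : nat) : R := iter u fwd f a 0%N.

Lemma solD f a u k : (k < p a)%N -> sol f a (u + k) = iter u fwd f a k.
Proof. by move=> lk; have := solzD f u lk; rewrite -PoszD. Qed.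

Lemma sol_window f a k : (k < p a)%N -> sol f a k = f a k.
Proof. exact: (@solD f a 0). Qed.

Lemma sol_system f a u : sol f a u + sol f a (u + p a) =
  F (lc np (fun b k => sol f b (u + k)) a) (lc nm (fun b k => sol f b (u + k)) a).
Proof. exact: (solz_system f a u). Qed.

Definition fwd_periodic Om := forall f a k, (k < p a)%N -> iter Om fwd f a k = f a k.

Lemma fwd_periodicM Om m : fwd_periodic Om -> fwd_periodic (m * Om).
Proof.
move=> per; elim: m => [//|m IH] f a k lk.
by rewrite mulSn iterD per // IH.
Qed.

Lemma sol_periodic Om f a u : fwd_periodic Om -> sol f a (u + Om) = sol f a u.
Proof.
by move=> per; rewrite /sol iterD; apply: eq_iter_fwd => // *; apply: per.
Qed.

(** Delaying the solution by u0 puts the arbitrary state f at the time of the first coincidence, so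
    the recurrence becomes periodicity from time 0 on. *)
Lemma solz_recurrence_periodic (u0 u1 : nat) : (u0 <= u1)%N ->
  (forall f a (k : nat), (k < p a)%N ->
     let t := fun a u => solz f a (u - u0%:Z) in
     t a (u0 + k)%:Z = t a (u1 + k)%:Z) ->
  fwd_periodic (u1 - u0).
Proof.
move=> le01 H f a k lk; have /= := H f a k lk.
have -> : (u0 + k)%:Z - u0%:Z = 0 + k%:Z by lia.
have -> : (u1 + k)%:Z - u0%:Z = (u1 - u0)%N%:Z + k%:Z by lia.
by rewrite !solzD // => <-.
Qed.

End Evolution.

(** * Positivity *)

Section LogSumExp.
Variable R : realType.
Implicit Types x y z : R.

Definition lse x y : R := ln (expR x + expR y).

Lemma lse_gtl x y : x < lse x y.
Proof.
rewrite -{1}(expRK x) ltr_ln ?posrE ?expR_gt0 ?addr_gt0 ?expR_gt0 //.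
by rewrite ltrDl expR_gt0.
Qed.

Lemma lseC x y : lse x y = lse y x.
Proof. by rewrite /lse addrC. Qed.

Lemma lse_gtr x y : y < lse x y.
Proof. by rewrite lseC lse_gtl. Qed.

Lemma expR_lse x y : expR (lse x y) = expR x + expR y.
Proof. by rewrite lnK // posrE addr_gt0 // expR_gt0. Qed.

Lemma lse00 : lse 0 0 = ln 2.
Proof. by rewrite /lse expR0. Qed.

End LogSumExp.

Section Positivity.
Variables (R : realType) (r W : nat) (p : 'I_r -> nat).
Hypothesis p_gt0 : forall a, (0 < p a)%N.
Variables (np nm : 'I_r -> 'I_r -> nat -> nat).
Hypotheses (np0 : supported p np) (nm0 : supported p nm).

Variable Om : nat.
Hypotheses (Om_gt0 : (0 < Om)%N)
  (Om_per : fwd_periodic W p np nm (@lse R) Om).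

(** A multiple of the period larger than every p_a, so that the vanishing window fits inside one
    period of length M. *)
Let M := ((\max_a p a).+1 * Om)%N.

Let pM a : (p a < M)%N.
Proof.
rewrite /M (leq_trans (n := (\max_a p a).+1)) ?leq_pmulr // ltnS.
exact: leq_bigmax.
Qed.

Let t : 'I_r -> nat -> R := sol W p np nm (@lse R) (fun _ _ => 0).

Let t_window a k : (k < p a)%N -> t a k = 0.
Proof. exact: sol_window. Qed.

Let t_per a u : t a (u + M)%N = t a u.
Proof. by apply: sol_periodic => //; apply: fwd_periodicM. Qed.

Let shift (u : nat) b k := t b (u + k)%N.

Let t_sys a u : t a u + t a (u + p a)%N = lse (lc W np (shift u) a) (lc W nm (shift u) a).
Proof. exact: sol_system. Qed.

Let t_first a : t a (p a) = ln 2.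
Proof.
have lc0 n : supported p n -> lc W n (shift 0) a = 0.
  move=> n0; rewrite (@eq_lc _ _ _ _ _ _ (fun _ _ => 0) a n0).
    by rewrite /lc big1 // => b _; rewrite big1 // => k _; rewrite mulr0.
  by move=> b k /andP[_ lk]; rewrite /shift t_window.
have := t_sys a 0; rewrite !lc0 // lse00 t_window ?p_gt0 //.
by rewrite add0r add0n.
Qed.

Let L (y : R) b := \sum_(u < M) y ^+ u * t b u.

(* The window of t vanishes, so that shifting t inside the sum produces no boundary terms. *)
Let L_shift y b k : 0 < y -> (k <= p b)%N ->
  \sum_(u < M) y ^+ u * t b (u + k)%N = y ^- k * L y b.
Proof.
move=> y0 lk; apply: (mulfI (expf_neq0 k (lt0r_neq0 y0))).
rewrite mulVKf ?expf_neq0 ?gt_eqF // mulr_sumr.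
transitivity (\sum_(u < M) y ^+ (u + k) * t b (u + k)%N).
  by apply: eq_bigr => u _; rewrite mulrA -exprD addnC.
elim: k lk => [|k IH] lk; first by apply: eq_bigr => u _; rewrite addn0.
rewrite -IH 1?ltnW //.
have := big_ord_recr (op := +%R) (idx := 0) M
  (fun u : 'I_M.+1 => y ^+ (u + k) * t b (u + k)%N).
rewrite big_ord_recl /= add0n t_window // mulr0 add0r addnC t_per t_window //.
by rewrite mulr0 addr0 => <-; apply: eq_bigr => u _; rewrite addnS.
Qed.

(** The inequality at time u is weighted by y^u and summed over a period; [L_shift] turns a shift by
    k into the factor y^-k. *)
Let L_pos (n : 'I_r -> 'I_r -> nat -> nat) y a : supported p n -> 0 < y ->
  (forall u, lc W n (shift u) a < t a u + t a (u + p a)%N) ->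
  \sum_(b < r) \sum_(k < W) (n b a k)%:R * (y ^- k * L y b) < L y a + y ^- p a * L y a.
Proof.
move=> n0 y0 H; rewrite -(L_shift y0 (leqnn (p a))) -big_split /=.
rewrite (_ : \sum_b _ = \sum_(u < M) y ^+ u * lc W n (shift u) a); last first.
  transitivity (\sum_(b < r) \sum_(k < W) \sum_(u < M) y ^+ u * ((n b a k)%:R * t b (u + k)%N)).
    apply: eq_bigr => b _; apply: eq_bigr => k _.
    have [/andP[_ lk]|/n0 ->] := boolP (0 < k < p b)%N; last first.
      by rewrite mul0r big1 // => u _; rewrite mul0r mulr0.
    rewrite -L_shift 1?ltnW // mulr_sumr; apply: eq_bigr => u _; ring.
  under eq_bigr do rewrite exchange_big /=.
  rewrite exchange_big /=; apply: eq_bigr => u _.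
  by rewrite /lc mulr_sumr; apply: eq_bigr => b _; rewrite mulr_sumr.
apply: ltr_sum => [|u _]; last by rewrite -mulrDr ltr_pM2l ?exprn_gt0.
by apply/hasP; exists (Ordinal (leq_ltn_trans (leq0n _) (pM a))); rewrite ?mem_index_enum.
Qed.

(** [L y b] divided by y^p_b, the power split off by the vanishing window. The constant term is
    t_b(p_b) = ln 2, which gives positivity at y = 0. *)
Let Q b : {poly R} := \poly_(u < M - p b) t b (p b + u)%N.

Let L_Q y b : L y b = y ^+ p b * (Q b).[y].
Proof.
rewrite /L -(big_mkord predT (fun u => y ^+ u * t b u)).
rewrite (big_cat_nat (n := p b)) ?(ltnW (pM b)) //= big_nat_cond big1 ?add0r; last first.
  by move=> u; rewrite andbT => /andP[_ /t_window ->]; rewrite mulr0.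
rewrite -{1}(add0n (p b)) big_addn big_mkord /Q horner_poly mulr_sumr.
by apply: eq_bigr => u _; rewrite addnC exprD; ring.
Qed.

(* A first zero y of min_b Q_b(y) is excluded: there Q >= 0 with some Q_b = 0, against L_pos. *)
Let Q1_gt0 a : 0 < (Q a).[1].
Proof.
(* The cap 1 gives the minimum a value when r = 0; being positive, it leaves every zero of [m] a
   zero of some Q_b. *)
pose m (y : R) := \big[Order.min/1]_b (Q b).[y].
suff: 0 < m 1 by move/bigmin_gtP => [_ ->].
have Q0 b : 0 < (Q b).[0].
  by rewrite horner_coef0 coef_poly subn_gt0 pM addn0 t_first ln_gt0 // ltr1n.
have m0 : 0 < m 0 by apply/bigmin_gtP; split.
rewrite ltNge; apply/negP => m1.
have cm : continuous (m : R -> R).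
  move=> y; rewrite /m; elim: (index_enum _) => [|b s IH].
    by under eq_fun do rewrite big_nil; exact: cvg_cst.
  under eq_fun do rewrite big_cons.
  by apply: continuous_min => //; apply: continuous_horner.
have [y] : exists2 c, c \in `[0, 1] & m c = 0.
  apply: IVT => //; first by apply: continuous_subspaceT.
  by rewrite ge_min m1 orbT le_max (ltW m0).
rewrite in_itv /= => /andP[y_ge0 _] my.
have y0 : 0 < y.
  rewrite lt_def y_ge0 andbT; apply/eqP => E.
  by move: m0; rewrite -{2}E my ltxx.
have Qy b : 0 <= (Q b).[y] by rewrite -my; apply: bigmin_le.
have [b Qb0] : exists b, (Q b).[y] = 0.
  have /bigmin_leP[] : m y <= 0 by rewrite my.
    by rewrite leNgt ltr01.
  by move=> [b _ Qb]; exists b; apply/eqP; rewrite eq_le Qb Qy.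
have Lb : L y b = 0 by rewrite L_Q Qb0 mulr0.
have := @L_pos np y b np0 y0; rewrite Lb mulr0 addr0 ltNge.
rewrite sumr_ge0 // => [|c _]; last first.
  apply: sumr_ge0 => k _; rewrite !mulr_ge0 ?ler0n ?invr_ge0 ?exprn_ge0 //.
  by rewrite L_Q mulr_ge0 ?exprn_ge0.
by move=> H; suff: ~~ true by []; apply: H => u; rewrite t_sys lse_gtl.
Qed.

(** The vector is L(1), the sum of the solution over a period; it serves both forms because lse
    exceeds each of its arguments. *)
Theorem simultaneous_positivity : exists l : 'I_r -> R, (forall a, 0 < l a) /\
  forall a, lc W np (fun b _ => l b) a < 2 * l a /\
            lc W nm (fun b _ => l b) a < 2 * l a.
Proof.
exists (L 1); split=> [a|a]; first by rewrite L_Q expr1n mul1r Q1_gt0.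
have H n : supported p n ->
    (forall u, lc W n (shift u) a < t a u + t a (u + p a)%N) ->
    lc W n (fun b _ => L 1 b) a < 2 * L 1 a.
  move=> n0 /(L_pos n0 ltr01); rewrite expr1n invr1 mul1r -mulr2n mulr_natl.
  rewrite /lc; under eq_bigr do under eq_bigr do rewrite expr1n invr1 mul1r.
  by [].
by split; apply: H => // u; rewrite t_sys ?lse_gtl ?lse_gtr.
Qed.

End Positivity.

(** * Maximum principle and constant solutions *)

Section LogSumExpOrder.
Variable R : realType.
Implicit Types x y : R.

Lemma le_lse x x' y y' : x <= x' -> y <= y' -> lse x y <= lse x' y'.
Proof.
move=> xx yy; rewrite ler_ln ?posrE ?addr_gt0 ?expR_gt0 //.
by rewrite lerD // ler_expR.
Qed.

Lemma lseD x y c : lse (x + c) (y + c) = lse x y + c.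
Proof.
by rewrite /lse !expRD -mulrDl lnM ?posrE ?addr_gt0 ?expR_gt0 // expRK.
Qed.

Lemma lse_le_max x y : lse x y <= Order.max x y + ln 2.
Proof.
rewrite -lse00 -[leRHS]addrC -lseD !add0r.
by apply: le_lse; rewrite le_max lexx ?orbT.
Qed.

(** Follows from monotonicity and compatibility with translations; it brings differences of constant
    solutions under [max_principle]. *)
Lemma lse_sub_le x x' y y' : lse x y - lse x' y' <= Order.max (x - x') (y - y').
Proof.
rewrite lerBlDl -lseD.
by apply: le_lse; rewrite -lerBlDl le_max lexx ?orbT.
Qed.

End LogSumExpOrder.

Section ConstantSolution.
Variables (R : realType) (r W : nat) (np nm : 'I_r -> 'I_r -> nat -> nat).

Definition lcc n (t : 'I_r -> R) a := lc W n (fun b _ => t b) a.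

Lemma le_lcc n s t a : (forall b, s b <= t b) -> lcc n s a <= lcc n t a.
Proof.
move=> st; apply: ler_sum => b _; apply: ler_sum => k _.
by rewrite ler_wpM2l ?ler0n.
Qed.

Lemma lccZ n c t a : lcc n (fun b => c * t b) a = c * lcc n t a.
Proof.
rewrite /lcc /lc mulr_sumr; apply: eq_bigr => b _.
by rewrite mulr_sumr; apply: eq_bigr => k _; ring.
Qed.

Lemma lccB n s t a : lcc n (fun b => s b - t b) a = lcc n s a - lcc n t a.
Proof.
rewrite /lcc /lc -sumrB; apply: eq_bigr => b _.
by rewrite -sumrB; apply: eq_bigr => k _; ring.
Qed.

Variable l : 'I_r -> R.
Hypotheses (l_gt0 : forall a, 0 < l a)
  (lp : forall a, lcc np l a < 2 * l a) (lm : forall a, lcc nm l a < 2 * l a).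

(** Otherwise let c > 0 be the largest quotient d_b / l_b, attained at a. Then d <= c l with
    equality at a, so both forms at a stay below 2 c l_a = 2 d_a. *)
Lemma max_principle (d : 'I_r -> R) :
  (forall a, 2 * d a <= Order.max (lcc np d a) (lcc nm d a)) -> forall a, d a <= 0.
Proof.
move=> H a0; rewrite leNgt; apply/negP => da0.
have [a _ amax] : exists2 a, true & forall b, d b / l b <= d a / l a.
  case: (@arg_maxP _ _ _ a0 predT (fun b => d b / l b) isT) => a _ amax.
  by exists a => // b; apply: amax.
set c := d a / l a in amax.
have c0 : 0 < c by apply: lt_le_trans (amax a0); rewrite divr_gt0.
have dc b : d b <= c * l b by rewrite -ler_pdivrMr ?amax.
have da : d a = c * l a by rewrite /c divfK // gt_eqF.
have := H a; rewrite leNgt => /negP; apply.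
rewrite gt_max !da.
have P n : lcc n l a < 2 * l a -> lcc n d a < 2 * (c * l a).
  move=> h; apply: le_lt_trans (le_lcc n a dc) _.
  by rewrite lccZ mulrCA ltr_pM2l.
by rewrite !P.
Qed.

Definition constant_solution (t : 'I_r -> R) :=
  forall a, 2 * t a = lse (lcc np t a) (lcc nm t a).

Lemma constant_solution_unique s t :
  constant_solution s -> constant_solution t -> s =1 t.
Proof.
have half s' t' : constant_solution s' -> constant_solution t' -> forall a, s' a <= t' a.
  move=> Hs Ht a; rewrite -subr_le0.
  apply: (@max_principle (fun b => s' b - t' b)) => b.
  by rewrite mulrBr Hs Ht !lccB lse_sub_le.
by move=> Hs Ht a; apply/eqP; rewrite eq_le !half.
Qed.

(** Knaster-Tarski: t is the pointwise supremum of the s <= G s in the box between 0 and C l. *)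
Lemma constant_solution_exists : exists t, constant_solution t.
Proof.
(* C l is a supersolution once C (2 l_a - lcc n l a) >= ln 2 for all a and both forms n; the sum of
   all the required lower bounds is such a C. *)
pose C : R := \sum_a (ln 2 / (2 * l a - lcc np l a) + ln 2 / (2 * l a - lcc nm l a)).
have ln2 : 0 < ln 2 :> R by rewrite ln_gt0 // ltr1n.
have term0 a : 0 <= ln 2 / (2 * l a - lcc np l a) + ln 2 / (2 * l a - lcc nm l a).
  by rewrite addr_ge0 // divr_ge0 ?(ltW ln2) // subr_ge0 ltW.
have C0 : 0 <= C by apply: sumr_ge0.
pose top b := C * l b.
have top_sup a : lse (lcc np top a) (lcc nm top a) <= 2 * top a.
  apply: le_trans (lse_le_max _ _) _; rewrite /top !lccZ.
  have Ca : ln 2 / (2 * l a - lcc np l a) + ln 2 / (2 * l a - lcc nm l a) <= C.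
    by rewrite /C (bigD1 a) //= lerDl sumr_ge0.
  have P n : lcc n l a < 2 * l a -> ln 2 / (2 * l a - lcc n l a) <= C ->
      C * lcc n l a + ln 2 <= 2 * (C * l a).
    move=> h; rewrite ler_pdivrMr ?subr_gt0 // => h'.
    by rewrite mulrCA -lerBrDl -mulrBr.
  have [h|h] := leP (C * lcc np l a) (C * lcc nm l a); apply: P => //.
    by apply: le_trans Ca; rewrite lerDr divr_ge0 ?(ltW ln2) // subr_ge0 ltW.
  by apply: le_trans Ca; rewrite lerDl divr_ge0 ?(ltW ln2) // subr_ge0 ltW.
pose G (s : 'I_r -> R) a := lse (lcc np s a) (lcc nm s a) / 2.
have GM s t : (forall a, s a <= t a) -> forall a, G s a <= G t a.
  by move=> st a; rewrite ler_pM2r ?invr_gt0 ?ltr0n // le_lse // le_lcc.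
pose S : set ('I_r -> R) :=
  [set s | forall a, 0 <= s a <= top a /\ s a <= G s a].
have S0 : S (fun=> 0).
  move=> a; rewrite lexx /top mulr_ge0 ?(ltW (l_gt0 _)) //; split => //.
  rewrite /G divr_ge0 ?ler0n //.
  have E n : lcc n (fun=> 0) a = 0.
    by rewrite /lcc /lc big1 // => b _; rewrite big1 // => k _; rewrite mulr0.
  by rewrite !E lse00 ltW.
pose t a := sup [set s a | s in S].
have hs a : has_sup [set s a | s in S].
  split; first by exists 0, (fun=> 0).
  by exists (top a) => _ [s Ss <-]; have [/andP[]] := Ss a.
have ubt s : S s -> forall a, s a <= t a.
  by move=> Ss a; apply: sup_upper_bound => //; exists s.
have t_top a : t a <= top a.
  apply: sup_le_ub; first by case: (hs a).
  by move=> _ [s Ss <-]; have [/andP[]] := Ss a.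
have tG a : t a <= G t a.
  apply: sup_le_ub; first by case: (hs a).
  move=> _ [s Ss <-]; have [_ h] := Ss a; apply: le_trans h _.
  exact: GM (ubt s Ss) a.
have t0 a : 0 <= t a by exact: (ubt _ S0).
exists t => a.
suff -> : t a = G t a by rewrite /G mulrC divfK // pnatr_eq0.
(* [G t] is again a member of S, hence lies below the supremum. *)
apply/eqP; rewrite eq_le tG /=; apply: (ubt (G t)) => b.
split; last exact: GM.
rewrite (le_trans (t0 b) (tG b)) /=.
apply: le_trans (GM _ _ t_top b) _.
by rewrite /G ler_pdivrMr ?ltr0n // mulrC.
Qed.

End ConstantSolution.

(** * The value of zeta(2) *)

Section Basel.
Variable R : realType.
Implicit Types x : R.

Lemma sin_le_id x : 0 <= x -> sin x <= x.
Proof.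
move=> x0; have [|c _] := @MVT_segment R sin cos 0 x x0 (fun y _ => is_derive_sin y).
  by apply: continuous_subspaceT; exact: continuous_sin.
by rewrite sin0 !subr0 => ->; rewrite ler_piMl // cos_le1.
Qed.

Lemma id_le_tan x : 0 <= x < pi / 2 -> x <= tan x.
Proof.
move=> /andP[x0 xpi].
have cpos y : y \in `[0, x] -> 0 < cos y.
  rewrite in_itv /= => /andP[y0 yx]; apply: cos_gt0_pihalf.
  rewrite (lt_le_trans _ y0) ?oppr_lt0 ?divr_gt0 ?pi_gt0 //=.
  exact: le_lt_trans xpi.
have [||c cin] := @MVT_segment R tan (fun y => (cos y) ^- 2) 0 x x0.
- move=> y yin; apply: is_derive_tan; rewrite gt_eqF //; apply: cpos.
  exact: subset_itv_oo_cc yin.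
- apply: continuous_in_subspaceT => y; rewrite inE => /cpos cy.
  by apply: continuous_tan; rewrite gt_eqF.
rewrite tan0 !subr0 => ->; rewrite ler_peMl // invf_ge1 ?exprn_gt0 ?cpos //.
Qed.

(** Inverse squares of sin x <= x <= tan x, since tan^-2 = sin^-2 - 1. *)
Lemma inv_sq_bounds x : 0 < x < pi / 2 ->
  (sin x) ^- 2 - 1 <= x ^- 2 <= (sin x) ^- 2.
Proof.
move=> /andP[x0 xpi].
have s0 : 0 < sin x by apply: sin_gt0_pihalf; rewrite x0.
have c0 : 0 < cos x.
  by apply: cos_gt0_pihalf; rewrite xpi (lt_trans _ x0) // oppr_lt0 divr_gt0 ?pi_gt0.
apply/andP; split; last first.
  by rewrite lef_pV2 ?posrE ?exprn_gt0 // lerXn2r ?nnegrE ?(ltW s0) ?(ltW x0) // sin_le_id // ltW.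
have E : (sin x) ^- 2 - 1 = (tan x) ^- 2.
  by rewrite /tan expr_div_n invf_div cos2sin2; field; rewrite gt_eqF.
have t0 : 0 < tan x by rewrite divr_gt0.
rewrite E lef_pV2 ?posrE ?exprn_gt0 // lerXn2r ?nnegrE ?(ltW t0) ?(ltW x0) //.
by apply: id_le_tan; rewrite ltW.
Qed.

(** The cosine is written as the sine of the complementary angle, so that both terms on the right
    are again sample values in [sum_inv_sin_sq]. *)
Lemma inv_sin_sq_half x : sin (x *+ 2) != 0 ->
  (sin (x *+ 2)) ^- 2 = 4^-1 * ((sin x) ^- 2 + (sin (pi / 2 - x)) ^- 2).
Proof.
have -> : sin (pi / 2 - x) = cos x by rewrite sinB sin_pihalf cos_pihalf; ring.
rewrite sin_mulr2n mulrn_eq0 /= mulf_eq0 negb_or => /andP[c0 s0].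
have := cos2Dsin2 x => E.
transitivity (4^-1 * ((cos x ^+ 2 + sin x ^+ 2) / (cos x ^+ 2 * sin x ^+ 2))).
  by rewrite E; field; rewrite c0 s0.
by field; rewrite c0 s0.
Qed.

Let pt N k : R := (k.*2.+1)%:R * pi / (4 * N)%:R.

Let pt_bounds N k : (k < N)%N -> 0 < pt N k < pi / 2.
Proof.
move=> kN; have N0 : (0 < N)%N by lia.
have p0 := @pi_gt0 R.
rewrite /pt divr_gt0 ?mulr_gt0 ?ltr0n //; last by lia.
rewrite ltr_pdivrMr ?ltr0n ?muln_gt0 // [ltRHS]mulrC mulrA.
rewrite ltr_pdivlMr ?ltr0n // mulrAC ltr_pM2r //.
by rewrite -natrM ltr_nat; lia.
Qed.

(* The halving formula sends the sample points k |-> (2k+1)pi/(4N) to those for 2N. *)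
Lemma sum_inv_sin_sq j :
  \sum_(k < 2 ^ j) (sin (pt (2 ^ j) k)) ^- 2 = 2 * (2 ^ j)%:R ^+ 2.
Proof.
elim: j => [|j IH].
  rewrite expn0 big_ord1 /pt mul1r muln1.
  have E : (pi / 4 : R) *+ 2 = pi / 2 by rewrite -mulr_natl; field.
  have := @inv_sin_sq_half (pi / 4); rewrite E sin_pihalf oner_neq0.
  have -> : pi / 2 - pi / 4 = pi / 4 :> R by field.
  move=> /(_ isT); rewrite expr1n invr1 => H; lra.
set N := (2 ^ j)%N in IH *.
have E2 : (2 ^ j.+1 = N + N)%N by rewrite expnS mul2n addnn.
have N0 : (0 < N)%N by rewrite expn_gt0.
rewrite E2 big_split_ord /=.
(* Reversing the second half of the range pairs each sample point with its complementary angle. *)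
rewrite [X in _ + X](reindex_inj rev_ord_inj) /= -big_split /=.
transitivity (\sum_(k < N) 4 * (sin (pt N k)) ^- 2).
  apply: eq_bigr => k _; have kN := ltn_ord k.
  have E : pt N k = pt (N + N) k *+ 2.
    rewrite /pt -mulr_natl !natrM (natrD _ N N); field.
    by rewrite -natrD !pnatr_eq0 -!lt0n addn_gt0 N0.
  rewrite E inv_sin_sq_half; last first.
    by rewrite -E gt_eqF // sin_gt0_pihalf // pt_bounds.
  have -> : pt (N + N) (N + (N - k.+1)) = pi / 2 - pt (N + N) k.
    rewrite /pt; have -> : ((N + (N - k.+1)).*2.+1 = (4 * N) - k.*2.+1)%N by lia.
    rewrite natrB; last by lia.
    rewrite !natrM (natrD _ N N); field.
    by rewrite -natrD !pnatr_eq0 -!lt0n addn_gt0 N0.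
  by rewrite mulrA divff ?pnatr_eq0 // mul1r.
by rewrite -mulr_sumr IH natrD; ring.
Qed.

Definition odd_zeta2 N : R := \sum_(k < N) (k.*2.+1)%:R ^- 2.

(** Each term is pi^2 / (16 N^2) times the inverse square of a sample point; passing from the point
    to its sine changes that inverse square by at most 1. *)
Lemma odd_zeta2_bounds j :
  pi ^+ 2 / 8 - pi ^+ 2 / 16 / (2 ^ j)%:R <= odd_zeta2 (2 ^ j) <= pi ^+ 2 / 8.
Proof.
set N : R := (2 ^ j)%:R; have p0 := @pi_gt0 R.
have N0 : 0 < N by rewrite ltr0n expn_gt0.
have Nn0 : N != 0 by rewrite gt_eqF.
have pn0 : pi != 0 :> R by rewrite gt_eqF.
have alg (P M q : R) : P != 0 -> M != 0 -> q != 0 ->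
    q ^- 2 = P ^+ 2 / (16 * M ^+ 2) * (q * P / (4 * M)) ^- 2.
  by move=> P0 M0 q0; field; rewrite P0 M0 q0.
have E : odd_zeta2 (2 ^ j) = pi ^+ 2 / (16 * N ^+ 2) * \sum_(k < 2 ^ j) (pt (2 ^ j) k) ^- 2.
  rewrite mulr_sumr; apply: eq_bigr => k _; rewrite /pt natrM.
  by apply: (alg _ _ _ pn0 Nn0); rewrite pnatr_eq0.
have S := sum_inv_sin_sq j; rewrite -/N in S.
have c0 : 0 < pi ^+ 2 / (16 * N ^+ 2).
  by apply: divr_gt0; [exact: exprn_gt0|apply: mulr_gt0 => //; exact: exprn_gt0].
apply/andP; split.
  have -> : pi ^+ 2 / 8 - pi ^+ 2 / 16 / N = pi ^+ 2 / (16 * N ^+ 2) * (2 * N ^+ 2 - N).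
    by field.
  rewrite E ler_pM2l // -S.
  have -> : N = \sum_(k < 2 ^ j) 1 by rewrite sumr_const card_ord.
  rewrite -sumrB; apply: ler_sum => k _.
  by have /andP[] := inv_sq_bounds (pt_bounds (ltn_ord k)).
have -> : pi ^+ 2 / 8 = pi ^+ 2 / (16 * N ^+ 2) * (2 * N ^+ 2) by field.
rewrite E ler_pM2l // -S; apply: ler_sum => k _.
by have /andP[] := inv_sq_bounds (pt_bounds (ltn_ord k)).
Qed.

Definition part_zeta2 m : R := \sum_(1 <= n < m) n%:R ^- 2.

Lemma part_zeta2_double N : part_zeta2 (N.*2.+1) = odd_zeta2 N + part_zeta2 N.+1 / 4.
Proof.
elim: N => [|N IH]; first by rewrite /part_zeta2 /odd_zeta2 !big_nil !big_ord0; ring.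
rewrite doubleS /part_zeta2 big_nat_recr //= big_nat_recr //= -/(part_zeta2 _) IH.
rewrite [X in _ = _ + X / 4]big_nat_recr //= -/(part_zeta2 _) /odd_zeta2 big_ord_recr /=.
have -> : (N.*2.+2)%:R = 2 * N.+1%:R :> R by rewrite -natrM; congr (_%:R); lia.
have -> : part_zeta2 N.+1 = \sum_(1 <= n < N.+1) n%:R ^- 2 by [].
by field; rewrite !nat1r !pnatr_eq0.
Qed.

(** The doubling step x |-> pi^2/8 + x/4 fixes pi^2/6, and the error constant reproduces itself:
    1/16 + (1/4)/4 = (1/4)/2. *)
Lemma part_zeta2_pow2 j : pi ^+ 2 / 6 - pi ^+ 2 / 4 / (2 ^ j)%:R <= part_zeta2 (2 ^ j).+1 <= pi ^+ 2 / 6.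
Proof.
have p2 : 0 < pi ^+ 2 :> R by rewrite exprn_gt0 ?pi_gt0.
elim: j => [|j /andP[IH1 IH2]].
  have /andP[_] := odd_zeta2_bounds 0.
  rewrite /odd_zeta2 /part_zeta2 expn0 big_ord1 big_nat1 invr1 expr1n invr1 => h.
  by apply/andP; split; lra.
have /andP[h1 h2] := odd_zeta2_bounds j.
have -> : ((2 ^ j.+1).+1 = (2 ^ j).*2.+1)%N by rewrite expnS mul2n.
rewrite part_zeta2_double; apply/andP; split; last by lra.
rewrite expnS natrM invfM.
set i := (2 ^ j)%:R^-1 in h1 IH1 *.
have i0 : 0 <= i by rewrite invr_ge0 ler0n.
have : 0 <= pi ^+ 2 * i by rewrite mulr_ge0 // ltW.
move: h1 IH1; lra.
Qed.

Lemma nondecreasing_part_zeta2 : nondecreasing_seq part_zeta2.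
Proof.
move=> m n mn; rewrite /part_zeta2; have [m1|m0] := leqP 1 m.
  by rewrite [leRHS](big_cat_nat (n := m)) //= lerDl sumr_ge0.
by rewrite big_geq 1?ltnW // sumr_ge0 // => i _; rewrite invr_ge0 exprn_ge0.
Qed.

Theorem zeta2 : part_zeta2 @ \oo --> pi ^+ 2 / 6.
Proof.
have p2 : 0 < pi ^+ 2 :> R by rewrite exprn_gt0 ?pi_gt0.
have le2 m : part_zeta2 m <= pi ^+ 2 / 6.
  have /andP[_ h] := part_zeta2_pow2 m.
  by apply: le_trans h; apply: nondecreasing_part_zeta2; rewrite ltnW // ltnS ltnW // ltn_expl.
apply/cvgrPdist_le => e e0.
have [j lej] : exists j : nat, pi ^+ 2 / 4 / (2 ^ j)%:R <= e.
  exists (Num.bound (pi ^+ 2 / 4 / e)); rewrite ler_pdivrMr ?ltr0n ?expn_gt0 //.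
  rewrite [leRHS]mulrC -ler_pdivrMr // ltW //.
  apply: lt_le_trans (archi_boundP _) _; first by apply: divr_ge0; [apply: divr_ge0; [exact: ltW|]|exact: ltW].
  by rewrite ler_nat ltnW // ltn_expl.
near=> m.
rewrite ger0_norm ?subr_ge0 //.
have /andP[h _] := part_zeta2_pow2 j.
rewrite lerBlDr -lerBlDl; apply: le_trans (le_trans h _).
  by rewrite lerD2l lerN2.
apply: nondecreasing_part_zeta2; near: m; exact: nbhs_infty_ge.
Unshelve. all: by end_near. Qed.

End Basel.

(** * The Rogers dilogarithm *)

Section Dilogarithm.
Variable R : realType.
Implicit Types (x y z K : R) (c : nat -> R).

(** Linear growth allows for the second derived series in [is_derive_pseries]; the comparison is
    with the derivative of the geometric series. *)
Lemma is_cvg_pseries_linear c K : (forall n, 0 <= c n <= n.+1%:R) -> 0 <= K < 1 ->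
  cvgn (pseries c K).
Proof.
move=> c01 /andP[K0 K1]; rewrite /pseries.
have K10 : 0 < 1 - K by rewrite subr_gt0.
apply: (@series_le_cvg _ _ (fun n => n.+1%:R * K ^+ n)) => [n|n|n|].
- by have /andP[c0 _] := c01 n; rewrite mulr_ge0 ?exprn_ge0.
- by rewrite mulr_ge0 ?exprn_ge0.
- by have /andP[_ c1] := c01 n; rewrite ler_wpM2r ?exprn_ge0.
apply: nondecreasing_is_cvgn.
  by apply: nondecreasing_series => n _ _; rewrite mulr_ge0 ?exprn_ge0.
exists ((1 - K) ^- 2) => _ [n _ <-].
rewrite -[leRHS]mul1r ler_pdivlMr ?exprn_gt0 //.
have -> : series (fun n => n.+1%:R * K ^+ n) n * (1 - K) ^+ 2 =
    1 - K ^+ n * (1 + n%:R * (1 - K)).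
  elim: n => [|n IH]; first by rewrite /series /= big_nil; ring.
  by rewrite seriesSr mulrDl IH (exprS K) -natr1; ring.
by rewrite lerBlDr lerDl mulr_ge0 ?exprn_ge0 // addr_ge0 // mulr_ge0 // ltW.
Qed.

Lemma is_derive_pseries c x : c 0%N = 0 -> (forall n, 0 <= c n) ->
  (forall n, pseries_diffs c n <= 1) -> 0 <= x < 1 ->
  is_derive x (1 : R) (fun y => limn (pseries c y)) (limn (pseries (pseries_diffs c) x)).
Proof.
move=> c00 c0 c1 /andP[x0 x1].
have K01 : 0 <= (1 + x) / 2 < 1 by lra.
have d0 n : 0 <= pseries_diffs c n by rewrite mulr_ge0.
have cS n : c n <= 1.
  case: n => [|n]; first by rewrite c00.
  by apply: le_trans (c1 n); rewrite ler_peMl // ler1n.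
have n1 n : 1 <= n.+1%:R :> R by rewrite ler1n.
apply: (@pseries_snd_diffs _ c ((1 + x) / 2)).
- by apply: is_cvg_pseries_linear => // n; rewrite c0 (le_trans (cS n)).
- by apply: is_cvg_pseries_linear => // n; rewrite d0 (le_trans (c1 n)).
- apply: is_cvg_pseries_linear => // n.
  by rewrite mulr_ge0 //= ler_piMr.
- by rewrite !ger0_norm //; lra.
Qed.

Lemma is_derive_ln_comp (f : R -> R) x df : is_derive x (1 : R) f df -> 0 < f x ->
  is_derive x (1 : R) (fun y => ln (f y)) (df / f x).
Proof.
move=> fx f0; have lnf := is_derive1_ln f0.
by have := is_derive1_comp lnf fx; rewrite mulrC; apply.
Qed.

(** The difference [h] of the two sides vanishes at 0 and has derivative 0 on [0, x]. *)
Lemma pseries_log x : 0 <= x < 1 ->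
  limn (pseries (fun n => n%:R^-1) x) = - ln (1 - x).
Proof.
move=> /andP[x0 x1].
pose e n : R := n%:R^-1.
have de n : pseries_diffs e n = 1 by rewrite /pseries_diffs /e divff ?pnatr_eq0.
pose h y := limn (pseries e y) + ln (1 - y).
have dh y : 0 <= y < 1 -> is_derive y (1 : R) h 0.
  move=> y01; have /andP[y0 y1] := y01.
  have y1' : 0 < 1 - y by rewrite subr_gt0.
  have d1 : is_derive y (1 : R) (fun y => limn (pseries e y)) ((1 - y)^-1).
    have -> : (1 - y)^-1 = limn (pseries (pseries_diffs e) y).
      apply/esym/cvg_lim => //.
      have -> : pseries (pseries_diffs e) y = series (geometric 1 y).
        by rewrite /pseries; congr series; apply/funext => n /=; rewrite de.
      by have := @cvg_geometric_series _ 1 y; rewrite mul1r; apply; rewrite ger0_norm.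
    apply: is_derive_pseries => //; first by rewrite /e invr0.
      by move=> n; rewrite invr_ge0.
    by move=> n; rewrite de.
  have d2 : is_derive y (1 : R) (fun y => ln (1 - y)) ((0 - 1) / (1 - y)).
    apply: is_derive_ln_comp => //; apply: is_deriveB.
  have -> : 0 = (1 - y)^-1 + (0 - 1) / (1 - y) by rewrite sub0r mulN1r subrr.
  exact: is_deriveD.
have [||c _] := @MVT_segment R h (fun=> 0) 0 x x0.
- move=> y; rewrite in_itv /= => /andP[y0 yx]; apply: dh.
  by rewrite (ltW y0) (lt_trans yx).
- apply: derivable_within_continuous => y; rewrite in_itv /= => /andP[y0 yx].
  by have := dh y; rewrite y0 (le_lt_trans yx) // => /(_ isT) [].
rewrite mul0r /h subr0 ln1 addr0.
have -> : limn (pseries e 0) = 0.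
  rewrite (_ : pseries e 0 = fun=> 0) ?lim_cst //.
  apply/funext => n; rewrite /pseries /series /= big1 // => i _.
  by case: i => [|i]; rewrite /e ?invr0 ?mul0r // expr0n mulr0.
by rewrite subr0 => /eqP; rewrite addr_eq0 => /eqP.
Qed.

Definition part_Li2 x m : R := \sum_(1 <= n < m) x ^+ n / n%:R ^+ 2.

(** Since x^n <= x for n >= 1. The factor x yields both the limit 0 at x = 0 and the bound zeta(2)
    up to x = 1. *)
Lemma part_Li2_le x m : 0 <= x <= 1 -> part_Li2 x m <= x * (pi ^+ 2 / 6).
Proof.
move=> /andP[x0 x1].
apply: (@le_trans _ _ (x * part_zeta2 R m)).
  rewrite mulr_sumr; apply: ler_sum_nat => -[//|n] _; rewrite ler_wpM2r ?invr_ge0 ?exprn_ge0 //.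
  by rewrite exprS ler_piMr // exprn_ile1.
rewrite ler_wpM2l //; have := @nondecreasing_cvgn_le R _ (@nondecreasing_part_zeta2 R).
by move/(_ (cvgP _ (@zeta2 R)) m); rewrite (cvg_lim _ (@zeta2 R)).
Qed.

Lemma nondecreasing_part_Li2 x : 0 <= x -> nondecreasing_seq (part_Li2 x).
Proof.
move=> x0 m n mn; rewrite /part_Li2; have [m1|m0] := leqP 1 m.
  rewrite [leRHS](big_cat_nat (n := m)) //= lerDl sumr_ge0 // => i _.
  by rewrite divr_ge0 ?exprn_ge0.
by rewrite big_geq 1?ltnW // sumr_ge0 // => i _; rewrite divr_ge0 ?exprn_ge0.
Qed.

Lemma cvg_part_Li2 x : 0 <= x <= 1 -> part_Li2 x @ \oo --> Li2 x.
Proof.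
move=> x01; have /andP[x0 _] := x01.
apply: nondecreasing_is_cvgn; first exact: nondecreasing_part_Li2.
by exists (x * (pi ^+ 2 / 6)) => _ [m _ <-]; apply: part_Li2_le.
Qed.

Lemma part_Li2_le_Li2 x m : 0 <= x <= 1 -> part_Li2 x m <= Li2 x.
Proof.
move=> x01; have /andP[x0 _] := x01; apply: nondecreasing_cvgn_le.
  exact: nondecreasing_part_Li2.
by apply: cvgP; exact: cvg_part_Li2.
Qed.

Lemma Li2_le x : 0 <= x <= 1 -> Li2 x <= x * (pi ^+ 2 / 6).
Proof.
move=> x01; have c := cvg_part_Li2 x01; rewrite -(cvg_lim _ c) //.
apply: limr_le; first exact: cvgP c.
by near=> m; apply: part_Li2_le.
Unshelve. all: by end_near. Qed.

Lemma Li2_ge0 x : 0 <= x <= 1 -> 0 <= Li2 x.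
Proof. by move=> x01; apply: le_trans (part_Li2_le_Li2 0 x01); rewrite /part_Li2 big_nil. Qed.

Lemma is_derive_Li2 x : 0 < x < 1 -> is_derive x (1 : R) (@Li2 R) (- ln (1 - x) / x).
Proof.
move=> /andP[x0 x1].
have x01 : 0 <= x < 1 by rewrite ltW.
pose c n : R := n%:R ^- 2.
have dc n : pseries_diffs c n = n.+1%:R^-1.
  by rewrite /pseries_diffs /c; field; rewrite addrC natr1 pnatr_eq0.
have E : @Li2 R = fun y => limn (pseries c y).
  apply/funext => y; rewrite /Li2; congr (limn _); apply/funext => m.
  case: m => [|m]; first by rewrite /pseries /series /= !big_nil.
  rewrite /pseries /series /= [RHS]big_nat_recl //= /c expr0n invr0 mul0r add0r.
  by rewrite big_add1 /=; apply: eq_bigr => i _; rewrite mulrC.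
have -> : - ln (1 - x) / x = limn (pseries (pseries_diffs c) x).
  have Ck : cvgn (pseries (pseries_diffs c) x).
    apply: is_cvg_pseries_linear => // n.
    by rewrite dc invr_ge0 ler0n (@le_trans _ _ 1) ?invf_le1 ?ler1n.
  rewrite -pseries_log // -[RHS](mulKf (lt0r_neq0 x0)) mulrC; congr (_ * _).
  apply/cvg_lim => //; rewrite -(cvg_shiftS (pseries _ x)).
  rewrite (_ : [sequence _]_n = (fun n => x * pseries (pseries_diffs c) x n)); last first.
    apply/funext => n; rewrite /pseries /series /= big_nat_recl //= invr0 mul0r add0r.
    by rewrite mulr_sumr; apply: eq_bigr => i _; rewrite dc exprS; ring.
  by apply: cvgZr.
rewrite E; apply: is_derive_pseries => //.
- by rewrite /c expr0n invr0.
- by move=> n; rewrite invr_ge0 exprn_ge0.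
- by move=> n; rewrite dc invf_le1 ?ler1n.
Qed.

(** For Y = e^y this is 1 / (1 + Y): the interval ]0, 1[ is parametrised by the real line, and f |->
    1 - f becomes y |-> - y. *)
Definition logistic y : R := (1 + expR y)^-1.

Lemma logistic_bounds y : 0 < logistic y < 1.
Proof.
have e0 := expR_gt0 y; rewrite /logistic invr_gt0 addr_gt0 //=.
by rewrite invf_lt1 ?addr_gt0 // ltrDl.
Qed.

Lemma logisticN y : logistic (- y) = 1 - logistic y.
Proof.
have e0 := expR_gt0 y; rewrite /logistic expRN; field.
by rewrite !gt_eqF // ?addr_gt0.
Qed.

Lemma ln_logistic y : ln (logistic y) = - lse 0 y.
Proof. by rewrite /logistic lnV ?posrE ?addr_gt0 ?expR_gt0 // /lse expR0. Qed.

Lemma ln_1logistic y : ln (1 - logistic y) = - lse 0 (- y).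
Proof. by rewrite -logisticN ln_logistic. Qed.

Definition rogers_logistic y : R := Rogers_L (logistic y).

Lemma rogers_logisticE y :
  rogers_logistic y = Li2 (logistic y) + 2^-1 * lse 0 y * lse 0 (- y).
Proof. by rewrite /rogers_logistic /Rogers_L ln_logistic ln_1logistic; ring. Qed.

Lemma is_derive_logistic y :
  is_derive y (1 : R) logistic (- (logistic y * logistic (- y))).
Proof.
have e0 := expR_gt0 y.
have E : - (logistic y * logistic (- y)) = - (1 + expR y) ^- 2 *: (0 + expR y).
  rewrite logisticN /logistic /GRing.scale /=; field.
  by rewrite gt_eqF // addr_gt0.
rewrite E; apply: is_deriveV; first by rewrite gt_eqF // addr_gt0.
Qed.

Lemma is_derive_lse0 y : is_derive y (1 : R) (lse 0) (logistic (- y)).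
Proof.
have e0 := expR_gt0 y.
have -> : lse 0 = (fun y => ln (1 + expR y)) :> (R -> R).
  by apply/funext => z; rewrite /lse expR0.
have -> : logistic (- y) = (0 + expR y) / (1 + expR y).
  by rewrite /logistic expRN; field; rewrite !gt_eqF // addr_gt0.
by apply: is_derive_ln_comp; rewrite ?addr_gt0.
Qed.

(** This is (M P' - P M') / 2 for P = lse 0 (- y) and M = lse 0 y, an antisymmetric form to which
    the symplectic relation applies. *)
Lemma is_derive_rogers_logistic y : is_derive y (1 : R) rogers_logistic
  (- 2^-1 * (logistic (- y) * lse 0 (- y) + logistic y * lse 0 y)).
Proof.
have /andP[f0 f1] := logistic_bounds y.
have d1 : is_derive y (1 : R) (fun y => Li2 (logistic y)) (- (logistic (- y) * lse 0 (- y))).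
  have := is_derive1_comp (@is_derive_Li2 _ (logistic_bounds y)) (is_derive_logistic y).
  rewrite ln_1logistic opprK => d.
  suff -> : - (logistic (- y) * lse 0 (- y)) =
    lse 0 (- y) / logistic y * (- (logistic y * logistic (- y))) by [].
  by field; rewrite gt_eqF.
have d2 := is_derive_lse0 y.
have d3 : is_derive y (1 : R) (fun y => lse 0 (- y)) (- logistic y).
  have dN : is_derive y (1 : R) (fun y => - y) (- 1) by apply: is_deriveN.
  have := is_derive1_comp (is_derive_lse0 (- y)) dN.
  by rewrite opprK mulrN1.
rewrite (_ : rogers_logistic =
  (fun y => Li2 (logistic y)) + 2^-1 *: (lse 0 * (fun y => lse 0 (- y)))); last first.
  by apply/funext => z; rewrite rogers_logisticE -mulrA.
apply: is_derive_eq (is_deriveD d1 (is_deriveZ _ (is_deriveM d2 d3))) _.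
by rewrite /GRing.scale /=; field.
Qed.

Lemma logistic_le y : logistic y <= expR (- y).
Proof.
rewrite /logistic expRN lef_pV2 ?posrE ?addr_gt0 ?expR_gt0 //.
by rewrite lerDr.
Qed.

(** One factor is at most 2 e^(y/2) and the other at most e^-y. *)
Lemma lse0_prod_bounds y : 0 <= y ->
  0 <= lse 0 y * lse 0 (- y) <= 2 * expR (- (y / 2)).
Proof.
move=> y0.
have l0 z : 0 < lse 0 z by exact: lse_gtl.
rewrite mulr_ge0 ?(ltW (l0 _)) //=.
have ln2 : ln 2 <= 1 :> R by have := @le_ln1Dx R 1; rewrite (_ : 1 + 1 = 2) //; apply; lra.
have h1 : lse 0 y <= 2 * expR (y / 2).
  have := lse_le_max 0 y; rewrite (max_idPr y0).
  have := expR_ge1Dx (y / 2); lra.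
have h2 : lse 0 (- y) <= expR (- y).
  by rewrite /lse expR0; apply: le_ln1Dx; rewrite (lt_trans _ (expR_gt0 _)) // ltrN10.
apply: le_trans (ler_pM (ltW (l0 _)) (ltW (l0 _)) h1 h2) _.
rewrite -mulrA -expRD.
by have -> : y / 2 - y = - (y / 2) by field.
Qed.

Lemma cvgy_expR_half : expR (- (y / 2)) @[y --> +oo] --> (0 : R).
Proof.
apply: (@cvg_comp _ _ _ (fun y : R => y / 2) (fun y => expR (- y)) _ (pinfty_nbhs R)).
  apply/cvgryPge => A; near=> y; rewrite ler_pdivlMr //; near: y.
exact: cvgr_expR.
Unshelve. all: by end_near. Qed.

Lemma cvgy_lse0_prod : lse 0 y * lse 0 (- y) @[y --> +oo] --> (0 : R).
Proof.
apply: (@squeeze_cvgr _ _ _ _ (fun=> 0) (fun y => 2 * expR (- (y / 2)))).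
- by near=> y; apply: lse0_prod_bounds.
- exact: cvg_cst.
- by rewrite -(mulr0 2); apply: cvgZr; exact: cvgy_expR_half.
Unshelve. all: by end_near. Qed.

Lemma cvgy_rogers_logistic : rogers_logistic @ +oo --> (0 : R).
Proof.
have -> : rogers_logistic = (fun y => Li2 (logistic y) + 2^-1 * (lse 0 y * lse 0 (- y))).
  by apply/funext => y; rewrite rogers_logisticE mulrA.
rewrite [X in _ --> X](_ : _ = 0 + 2^-1 * 0); last by rewrite mulr0 addr0.
apply: cvgD; last by apply: cvgM; [exact: cvg_cst|exact: cvgy_lse0_prod].
apply: (@squeeze_cvgr _ _ _ _ (fun=> 0) (fun y => expR (- y) * (pi ^+ 2 / 6))).
- near=> y; have /andP[f0 f1] := logistic_bounds y.
  have f01 : 0 <= logistic y <= 1 by rewrite !ltW.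
  rewrite Li2_ge0 //=; apply: le_trans (Li2_le f01) _.
  rewrite ler_wpM2r ?logistic_le //.
  by rewrite divr_ge0 // exprn_ge0 // pi_ge0.
- exact: cvg_cst.
- by rewrite -(mul0r (pi ^+ 2 / 6)); apply: cvgZl; exact: cvgr_expR.
Unshelve. all: by end_near. Qed.

(** By Bernoulli's inequality the term of index n loses at most (1 - x) / n <= 1 - x. *)
Lemma part_Li2_near1 x m : 0 <= x <= 1 -> part_zeta2 R m - m%:R * (1 - x) <= part_Li2 x m.
Proof.
move=> /andP[x0 x1].
have bern n : 1 - n%:R * (1 - x) <= x ^+ n.
  elim: n => [|n IH]; first by rewrite mul0r subr0.
  have : (1 - n%:R * (1 - x)) * x <= x ^+ n * x by rewrite ler_wpM2r.
  rewrite exprSr; apply: le_trans; rewrite -natr1 -subr_ge0.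
  have -> : (1 - n%:R * (1 - x)) * x - (1 - (n%:R + 1) * (1 - x)) = n%:R * (1 - x) ^+ 2 by ring.
  by rewrite mulr_ge0 // sqr_ge0.
elim: m => [|m IH]; first by rewrite /part_zeta2 /part_Li2 !big_nil; lra.
case: m IH => [|m] IH; first by rewrite /part_zeta2 /part_Li2 !big_geq //; lra.
rewrite /part_zeta2 /part_Li2 big_nat_recr //= [leRHS]big_nat_recr //=.
rewrite -/(part_zeta2 R m.+1) -/(part_Li2 x m.+1).
have h : m.+1%:R ^- 2 - (1 - x) <= x ^+ m.+1 / m.+1%:R ^+ 2.
  apply: (@le_trans _ _ ((1 - m.+1%:R * (1 - x)) / m.+1%:R ^+ 2)); last first.
    by rewrite ler_wpM2r ?bern // invr_ge0 exprn_ge0.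
  rewrite mulrBl mul1r lerD2l lerN2.
  have -> : m.+1%:R * (1 - x) / m.+1%:R ^+ 2 = (1 - x) / m.+1%:R.
    by field; rewrite nat1r pnatr_eq0.
  by rewrite ler_pdivrMr // ler_peMr ?subr_ge0 // ler1n.
rewrite -(natr1 m.+1) mulrDl mul1r; move: IH h.
set u := m.+1%:R * (1 - x); set v := m.+1%:R ^- 2; set w := x ^+ m.+1 / _; lra.
Qed.

(** Near the argument 1, Li2 is squeezed between zeta(2) and a fixed partial sum that is already
    close to zeta(2); this takes the place of Abel's limit theorem. *)
Lemma cvgNy_rogers_logistic : rogers_logistic @ -oo --> (pi ^+ 2 / 6 : R).
Proof.
apply/cvgNy_compNP.
have -> : rogers_logistic \o -%R =
    (fun y => Li2 (logistic (- y)) + 2^-1 * (lse 0 y * lse 0 (- y))).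
  by apply/funext => y /=; rewrite rogers_logisticE opprK; ring.
rewrite (_ : pi ^+ 2 / 6 = pi ^+ 2 / 6 + 2^-1 * 0); last by rewrite mulr0 addr0.
apply: cvgD; last by apply: cvgM; [exact: cvg_cst|exact: cvgy_lse0_prod].
apply/cvgrPdist_le => e e0.
have [m hm] : exists m, pi ^+ 2 / 6 - e / 2 <= part_zeta2 R m.
  have /cvgrPdist_le /(_ (e / 2)) := @zeta2 R.
  rewrite divr_gt0 // => /(_ isT) [m _ /(_ m (leqnn m))] /=.
  by rewrite ler_norml => /andP[_ h]; exists m; move: h; lra.
near=> y.
have /andP[f0 f1] := logistic_bounds (- y).
have f01 : 0 <= logistic (- y) <= 1 by rewrite !ltW.
have ub : Li2 (logistic (- y)) <= pi ^+ 2 / 6.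
  apply: le_trans (Li2_le f01) _; rewrite ler_piMl ?(ltW f1) //.
  by rewrite divr_ge0 // exprn_ge0 // pi_ge0.
rewrite ger0_norm ?subr_ge0 //.
have h1 := le_trans (part_Li2_near1 m f01) (part_Li2_le_Li2 m f01).
have h2 : m%:R * (1 - logistic (- y)) <= e / 2.
  rewrite -logisticN opprK.
  apply: (@le_trans _ _ (m.+1%:R * expR (- y))).
    by rewrite ler_pM ?logistic_le ?ler_nat // ltW //; have /andP[] := logistic_bounds y.
  rewrite mulrC -ler_pdivlMr //; near: y.
  have /cvgrPdist_le /(_ (e / 2 / m.+1%:R)) := @cvgr_expR R.
  rewrite !divr_gt0 // => /(_ isT); apply: filterS => y.
  by rewrite sub0r normrN ger0_norm ?expR_ge0.
move: h1 h2 hm; lra.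
Unshelve. all: by end_near. Qed.

(** Euler's reflection: [H] has derivative 0, so H 0, twice the wanted value, is the sum of the
    limits 0 and pi^2/6. *)
Lemma rogers_logistic0 : rogers_logistic 0 = pi ^+ 2 / 12.
Proof.
pose H y := rogers_logistic y + rogers_logistic (- y).
have dH y : is_derive y (1 : R) H 0.
  have dN : is_derive y (1 : R) (fun y => - y) (- 1) by apply: is_deriveN.
  apply: is_derive_eq (is_deriveD (is_derive_rogers_logistic y)
    (is_derive1_comp (is_derive_rogers_logistic (- y)) dN)) _.
  by rewrite opprK; ring.
have H0 y : H y = H 0 by apply: is_derive_0_is_cst.
have : H @ +oo --> 0 + (pi ^+ 2 / 6 : R).
  apply: cvgD; first exact: cvgy_rogers_logistic.
  by have /cvgNy_compNP := cvgNy_rogers_logistic.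
have -> : H = fun=> H 0 by apply/funext.
move=> /(cvg_lim (@Rhausdorff R)); rewrite lim_cst //.
rewrite /H oppr0; lra.
Qed.

End Dilogarithm.

(** * Constancy of the dilogarithm sum *)

Section PeriodSum.
Variables (R : realFieldType).

Lemma period_sum_shift (Om m : nat) (g : nat -> R) : (forall u, g (u + Om)%N = g u) ->
  \sum_(u < Om) g (u + m)%N = \sum_(u < Om) g u.
Proof.
move=> per; elim: m => [|m IH]; first by apply: eq_bigr => u _; rewrite addn0.
rewrite -{}IH.
have := big_ord_recr (op := +%R) (idx := 0) Om (fun u : 'I_Om.+1 => g (u + m)%N).
rewrite big_ord_recl /= add0n addnC per addrC => /addIr <-.
by apply: eq_bigr => u _; rewrite addnS.
Qed.

End PeriodSum.

Section Symplectic.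
Variables (R : realFieldType) (r W : nat) (p : 'I_r -> nat).
Hypothesis pW : forall a, (p a < W)%N.
Variables (np nm : 'I_r -> 'I_r -> nat -> nat).

(** The coefficient of z^k in the entry (b, a) of N_0 - N when sigma is the identity. *)
Definition Acoef (n : 'I_r -> 'I_r -> nat -> nat) b a k : R :=
  (b == a)%:R * ((k == 0%N)%:R + (k == p b)%:R) - (n b a k)%:R.

Definition Aop (n : 'I_r -> 'I_r -> nat -> nat) (t : 'I_r -> nat -> R) a u : R :=
  t a u + t a (u + p a)%N - lc W n (fun b k => t b (u + k)%N) a.

Lemma AopE n t a u : Aop n t a u = \sum_b \sum_(i < W) Acoef n b a i * t b (u + i)%N.
Proof.
have delta b j : (j < W)%N -> \sum_(i < W) (i == j :> nat)%:R * t b (u + i)%N = t b (u + j)%N.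
  move=> jW; rewrite (bigD1 (Ordinal jW)) //= eqxx mul1r big1 ?addr0 // => i.
  by rewrite -val_eqE /= => /negPf ->; rewrite mul0r.
rewrite /Aop /lc.
transitivity (\sum_b ((b == a)%:R * (t b u + t b (u + p b)%N)
    - \sum_(i < W) (n b a i)%:R * t b (u + i)%N)).
  rewrite sumrB; congr (_ - _); rewrite (bigD1 a) //= eqxx mul1r big1 ?addr0 //.
  by move=> b /negPf ->; rewrite mul0r.
apply: eq_bigr => b _.
under [RHS]eq_bigr do rewrite mulrBl.
rewrite sumrB; congr (_ - _).
under [RHS]eq_bigr do rewrite -mulrA mulrDl.
rewrite -mulr_sumr big_split /= !delta ?addn0 //.
exact: leq_ltn_trans (pW b).
Qed.

Variable d : 'I_r -> R.

(* The coefficients of A_- D A_+^dagger = A_+ D A_-^dagger, tested against an arbitrary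
   function psi of the exponent; W - j stands for -j, shifted so as to remain nonnegative. *)
Definition symplectic_coef := forall (b c : 'I_r) (psi : nat -> R),
  \sum_(i < W) \sum_(j < W)
    (\sum_a d a * (Acoef nm b a i * Acoef np c a j - Acoef np b a i * Acoef nm c a j))
      * psi (i + (W - j))%N = 0.

(** The products are expanded bilinearly. Over a full period the correlation of t_b(u + i) with
    s_c(u + j) depends on i - j only, so it is a function of the exponent of z and can be taken as
    psi. *)
Lemma symplectic_sum (Om : nat) (t s : 'I_r -> nat -> R) : symplectic_coef ->
  (forall a u, t a (u + Om)%N = t a u) -> (forall a u, s a (u + Om)%N = s a u) ->
  \sum_(u < Om) \sum_a d a * (Aop nm t a u * Aop np s a u - Aop np t a u * Aop nm s a u) = 0.
Proof.
move=> symp pert pers.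
pose psi b c m := \sum_(u < Om) t b (u + m)%N * s c (u + W)%N.
transitivity (\sum_b \sum_c \sum_(i < W) \sum_(j < W)
    (\sum_a d a * (Acoef nm b a i * Acoef np c a j - Acoef np b a i * Acoef nm c a j))
      * psi b c (i + (W - j))%N); last first.
  by rewrite big1 // => b _; rewrite big1 // => c _.
have psiE b c (i j : 'I_W) :
    psi b c (i + (W - j))%N = \sum_(u < Om) t b (u + i)%N * s c (u + j)%N.
  have jW := ltnW (ltn_ord j).
  rewrite -(@period_sum_shift _ Om (W - j) (fun u => t b (u + i)%N * s c (u + j)%N)).
    apply: eq_bigr => u _; congr (t b _ * s c _); first by rewrite addnAC addnA.
    by rewrite -addnA subnK.
  by move=> u; rewrite addnAC pert addnAC pers.
have E n n' u a : Aop n t a u * Aop n' s a u = \sum_b \sum_c \sum_(i < W) \sum_(j < W)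
    (Acoef n b a i * Acoef n' c a j) * (t b (u + i)%N * s c (u + j)%N).
  rewrite !AopE mulr_suml; apply: eq_bigr => b _.
  rewrite mulr_sumr; apply: eq_bigr => c _.
  rewrite mulr_suml; apply: eq_bigr => i _.
  by rewrite mulr_sumr; apply: eq_bigr => j _; rewrite mulrACA.
transitivity (\sum_(u < Om) \sum_b \sum_c \sum_(i < W) \sum_(j < W)
    (\sum_a d a * (Acoef nm b a i * Acoef np c a j - Acoef np b a i * Acoef nm c a j))
      * (t b (u + i)%N * s c (u + j)%N)).
  apply: eq_bigr => u _.
  under eq_bigr => a _.
    rewrite !E -sumrB mulr_sumr; under eq_bigr => b _.
      rewrite -sumrB mulr_sumr; under eq_bigr => c _.
        rewrite -sumrB mulr_sumr; under eq_bigr => i _.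
          rewrite -sumrB mulr_sumr; under eq_bigr => j _ do rewrite -mulrBl mulrA.
          over.
        over.
      over.
    over.
  rewrite exchange_big; apply: eq_bigr => b _.
  rewrite exchange_big; apply: eq_bigr => c _.
  rewrite exchange_big; apply: eq_bigr => i _.
  rewrite exchange_big; apply: eq_bigr => j _.
  by rewrite mulr_suml.
rewrite exchange_big; apply: eq_bigr => b _.
rewrite exchange_big; apply: eq_bigr => c _.
rewrite exchange_big; apply: eq_bigr => i _.
rewrite exchange_big; apply: eq_bigr => j _.
by rewrite psiE mulr_sumr.
Qed.

End Symplectic.

(** * Differentiating along a line of initial windows *)

Section Differentiation.
Variables (R : realType) (r W : nat).
Implicit Types (x : R).

Lemma is_derive_sum_fun n (h : 'I_n -> R -> R) x (dh : 'I_n -> R) :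
  (forall i, is_derive x (1 : R) (h i) (dh i)) ->
  is_derive x (1 : R) (fun y => \sum_i h i y) (\sum_i dh i).
Proof.
move=> H; rewrite (_ : (fun y => _) = \sum_i h i); last first.
  by apply/funext => y; rewrite fct_sumE.
exact: is_derive_sum.
Qed.

Lemma is_derive_lc n a (F : R -> 'I_r -> nat -> R) x (dF : 'I_r -> nat -> R) :
  (forall b k, is_derive x (1 : R) (fun y => F y b k) (dF b k)) ->
  is_derive x (1 : R) (fun y => lc W n (F y) a) (lc W n dF a).
Proof.
move=> H; apply: is_derive_sum_fun => b; apply: is_derive_sum_fun => k.
Qed.

Lemma is_derive_comp (g f : R -> R) x dg df : is_derive (f x) (1 : R) g dg ->
  is_derive x (1 : R) f df -> is_derive x (1 : R) (fun y => g (f y)) (dg * df).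
Proof. by move=> dg' df'; exact: (is_derive1_comp dg' df'). Qed.

Lemma lseE (x y : R) : lse x y = lse 0 (x - y) + y.
Proof. by rewrite -lseD add0r subrK lseC. Qed.

Lemma derivable_lse (f g : R -> R) x : derivable f x 1 -> derivable g x 1 ->
  derivable (fun y => lse (f y) (g y)) x 1.
Proof.
move=> /derivableP df /derivableP dg.
have -> : (fun y => lse (f y) (g y)) = (fun y => lse 0 (f y - g y)) + g.
  by apply/funext => y; rewrite lseE.
have h : is_derive x (1 : R) (fun y => f y - g y) ('D_1 f x - 'D_1 g x) by exact: is_deriveB.
by case: (is_deriveD (is_derive_comp (is_derive_lse0 _) h) dg).
Qed.

End Differentiation.

Section Constancy.
Variables (R : realType) (r W : nat) (p : 'I_r -> nat).
Hypotheses (p_gt0 : forall a, (0 < p a)%N) (pW : forall a, (p a < W)%N).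
Variables (np nm : 'I_r -> 'I_r -> nat -> nat).
Hypotheses (np0 : supported p np) (nm0 : supported p nm).
Variable Om : nat.
Hypothesis Om_per : fwd_periodic W p np nm (@lse R) Om.
Variable d : 'I_r -> R.
Hypothesis symp : symplectic_coef W p np nm d.

(** The logarithm of the Y-variable, the ratio of the two monomials on the right of the T-system. *)
Definition ylog (t : 'I_r -> nat -> R) a u :=
  lc W np (fun b k => t b (u + k)%N) a - lc W nm (fun b k => t b (u + k)%N) a.

Variables (t0 v : 'I_r -> nat -> R).

Definition ray (x : R) : 'I_r -> nat -> R := fun a k => t0 a k + x * v a k.

Let t x := sol W p np nm (@lse R) (ray x).

Lemma derivable_iter_fwd n a k x :
  derivable (fun y => iter n (fwd W p np nm (@lse R)) (ray y) a k) x 1.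
Proof.
elim: n a k x => [|n IH] a k x /=.
  rewrite /ray; have := is_deriveD (is_derive_cst (t0 a k) x (1 : R))
    (is_deriveM (is_derive_id x (1 : R)) (is_derive_cst (v a k) x 1)).
  by case.
rewrite /fwd; case: eqP => _ //.
have D m : derivable (fun y => lc W m (iter n (fwd W p np nm (@lse R)) (ray y)) a) x 1.
  have := @is_derive_lc R r W m a (fun y => iter n (fwd W p np nm (@lse R)) (ray y)) x _
    (fun b k => derivableP (IH b k x)).
  by case.
have d1 := derivableP (derivable_lse (D np) (D nm)).
by case: (is_deriveB d1 (derivableP (IH a 0%N x))).
Qed.

Let s x a u : R := 'D_1 (fun y => t y a u) x.

Let dt x a u : is_derive x (1 : R) (fun y => t y a u) (s x a u).
Proof. exact: derivableP (@derivable_iter_fwd u a 0%N x). Qed.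

Definition dilog_sum x : R := \sum_(u < Om) \sum_a d a * rogers_logistic (ylog (t x) a u).

Let t_per x a u : t x a (u + Om)%N = t x a u.
Proof. exact: sol_periodic. Qed.

Let s_per x a u : s x a (u + Om)%N = s x a u.
Proof. by rewrite /s; congr ('D_1 _ x); apply/funext => y; apply: t_per. Qed.

Let AmE x a u : Aop W p nm (t x) a u = lse 0 (ylog (t x) a u).
Proof. by rewrite /Aop [t x a u + _]sol_system // lseE addrK. Qed.

Let ApE x a u : Aop W p np (t x) a u = lse 0 (- ylog (t x) a u).
Proof. by rewrite /Aop [t x a u + _]sol_system // lseC lseE addrK opprB. Qed.

Let is_derive_Aop n x a u :
  is_derive x (1 : R) (fun y => Aop W p n (t y) a u) (Aop W p n (s x) a u).
Proof.
apply: is_deriveB; first exact: is_deriveD.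
exact: (@is_derive_lc R r W n a (fun y b k => t y b (u + k)%N)).
Qed.

Let is_derive_ylog x a u :
  is_derive x (1 : R) (fun y => ylog (t y) a u) (ylog (s x) a u).
Proof.
by apply: is_deriveB;
  exact: (@is_derive_lc R r W _ a (fun y b k => t y b (u + k)%N)).
Qed.

(** [Aop] is linear, so it commutes with d/dx; differentiating [ApE] gives the linearised T-system
    for the tangent vector s. *)
Let ApsE x a u : Aop W p np (s x) a u = - logistic (ylog (t x) a u) * ylog (s x) a u.
Proof.
have d1 := is_derive_Aop np x a u; rewrite -[LHS](@derive_val _ _ _ _ _ _ _ d1).
have -> : (fun y => Aop W p np (t y) a u) = (fun y => lse 0 (- ylog (t y) a u)).
  by apply/funext => y; rewrite ApE.
have dN : is_derive x (1 : R) (fun y => - ylog (t y) a u) (- ylog (s x) a u).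
  exact: is_deriveN (is_derive_ylog x a u).
have d2 := is_derive_comp (is_derive_lse0 _) dN.
rewrite derive_val opprK; ring.
Qed.

Let AmsE x a u : Aop W p nm (s x) a u = logistic (- ylog (t x) a u) * ylog (s x) a u.
Proof.
have d1 := is_derive_Aop nm x a u; rewrite -[LHS](@derive_val _ _ _ _ _ _ _ d1).
have -> : (fun y => Aop W p nm (t y) a u) = (fun y => lse 0 (ylog (t y) a u)).
  by apply/funext => y; rewrite AmE.
have d2 := is_derive_comp (is_derive_lse0 _) (is_derive_ylog x a u).
by rewrite derive_val.
Qed.

(** The derivative is half the symplectic sum of t against its tangent vector s. *)
Lemma dilog_sum_constant x y : dilog_sum x = dilog_sum y.
Proof.
apply: is_derive_0_is_cst => {y}x.
have D : is_derive x (1 : R) dilog_sum (\sum_(u < Om) \sum_a d a *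
    (- 2^-1 * (logistic (- ylog (t x) a u) * lse 0 (- ylog (t x) a u)
       + logistic (ylog (t x) a u) * lse 0 (ylog (t x) a u)) * ylog (s x) a u)).
  apply: is_derive_sum_fun => u; apply: is_derive_sum_fun => a.
  apply: (is_deriveZ (d a)).
  exact: is_derive_comp (is_derive_rogers_logistic _) (is_derive_ylog x a u).
apply: is_derive_eq D _.
rewrite -[RHS](mulr0 2^-1) -[X in _ = _ * X](symplectic_sum pW symp (t_per x) (s_per x)).
rewrite mulr_sumr; apply: eq_bigr => u _; rewrite mulr_sumr; apply: eq_bigr => a _.
by rewrite AmE ApE ApsE AmsE; ring.
Qed.

End Constancy.

(** * Tropical solutions *)

Section LogPrimes.
Variable R : realType.

Lemma ln_prod_nat (I : finType) (q n : I -> nat) : (forall i, (0 < q i)%N) ->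
  ln (\prod_i q i ^ n i)%N%:R = \sum_i (n i)%:R * ln (q i)%:R :> R.
Proof.
move=> q0.
pose K (x : nat) (y : R) := (0 < x)%N /\ ln x%:R = y.
suff [] : K (\prod_i q i ^ n i)%N (\sum_i (n i)%:R * ln (q i)%:R) by [].
elim/big_ind2: _ => [|x1 y1 x2 y2 [x10 <-] [x20 <-]|i _].
- by split=> //; rewrite ln1.
- by split; rewrite ?muln_gt0 ?x10 // natrM lnM ?posrE ?ltr0n.
- by split; rewrite ?expn_gt0 ?q0 // natrX lnXn ?ltr0n // mulr_natl.
Qed.

Lemma logn_prod_primes (I : finType) (q n : I -> nat) i :
  injective q -> (forall j, prime (q j)) -> logn (q i) (\prod_j q j ^ n j) = n i.
Proof.
move=> inj pr.
pose K (x y : nat) := (0 < x)%N /\ logn (q i) x = y.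
have [_ ->] : K (\prod_j q j ^ n j)%N (\sum_j n j * (q i == q j))%N.
  elim/big_ind2: _ => [|x1 y1 x2 y2 [x10 <-] [x20 <-]|j _].
  - by split=> //; rewrite logn1.
  - by split; rewrite ?muln_gt0 ?x10 // lognM.
  - by split; rewrite ?expn_gt0 ?prime_gt0 // lognX logn_prime.
rewrite (bigD1 i) //= eqxx muln1 big1 ?addn0 // => j ji.
by rewrite (inj_eq inj) eq_sym (negPf ji) muln0.
Qed.

(** Separating positive from negative coefficients gives an equality of two products of prime
    powers, and factorisation is unique. *)
Lemma ln_primes_free (I : finType) (q : I -> nat) (k : I -> int) :
  injective q -> (forall i, prime (q i)) ->
  \sum_i (k i)%:~R * ln (q i)%:R = 0 :> R -> forall i, k i = 0.
Proof.
move=> inj pr S0 i.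
have q0 j : (0 < q j)%N by rewrite prime_gt0.
pose n1 j := if 0 <= k j then `|k j|%N else 0%N.
pose n2 j := if 0 <= k j then 0%N else `|k j|%N.
have kE j : k j = (n1 j)%:Z - (n2 j)%:Z by rewrite /n1 /n2; case: ifP; lia.
have E : (\prod_j q j ^ n1 j = \prod_j q j ^ n2 j)%N.
  have pos (n : I -> nat) : (\prod_j q j ^ n j)%N%:R \is (@Num.pos R).
    by rewrite posrE ltr0n prodn_gt0 // => j; rewrite expn_gt0 q0.
  apply/eqP; rewrite -(eqr_nat R); apply/eqP; apply: ln_inj => //.
  rewrite !ln_prod_nat //; apply/eqP; rewrite -subr_eq0 -sumrB; apply/eqP.
  rewrite -[RHS]S0; apply: eq_bigr => j _.
  by rewrite kE intrD rmorphN /= -mulrBl.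
have := logn_prod_primes n1 i inj pr; rewrite E logn_prod_primes // => n12.
by rewrite kE n12 subrr.
Qed.

(** A strictly increasing sequence of primes; its successive terms need not be consecutive
    primes. *)
Definition nth_prime n := iter n (fun m => s2val (prime_above m)) 2.

Lemma prime_nth_prime n : prime (nth_prime n).
Proof. by case: n => // n; rewrite /nth_prime /=; case: prime_above. Qed.

Lemma nth_prime_inj : injective nth_prime.
Proof.
have H n : (nth_prime n < nth_prime n.+1)%N by rewrite /= ; case: prime_above.
have HH := homo_ltn ltn_trans H.
by move=> m n E; case: (ltngtP m n) => // /HH; rewrite E ltnn.
Qed.

End LogPrimes.

Section Tropical.
Variables (R : realType) (r W : nat) (p : 'I_r -> nat).
Hypotheses (p_gt0 : forall a, (0 < p a)%N) (pW : forall a, (p a < W)%N).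
Variables (np nm : 'I_r -> 'I_r -> nat -> nat).
Hypotheses (np0 : supported p np) (nm0 : supported p nm).
Hypothesis np_nm : forall b a k, (np b a k * nm b a k = 0)%N.

(** Linear independence of the window entries over the integers. *)
Definition window_free (f : 'I_r -> nat -> R) := forall k : 'I_r -> nat -> int,
  \sum_b \sum_(j < p b) (k b j)%:~R * f b j = 0 ->
  forall b j, (j < p b)%N -> k b j = 0.

Lemma lc_window n (f : 'I_r -> nat -> R) a : supported p n ->
  lc W n f a = \sum_b \sum_(j < p b) (n b a j)%:R * f b j.
Proof.
move=> n0; apply: eq_bigr => b _.
rewrite (big_ord_widen W (fun j => (n b a j)%:R * f b j) (ltnW (pW b))).
rewrite [RHS]big_mkcond /=; apply: eq_bigr => j _.
case: ifP => // /negbT jp; rewrite n0 ?mul0r //.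
by apply: contra jp => /andP[].
Qed.

Let tropical := fwd W p np nm (@Order.max _ R).

(* One step replaces f b 0 by - f b 0 plus an integer combination of the other entries of
   the window, which is a unimodular change. *)
Lemma tropical_free f : window_free f -> window_free (tropical f).
Proof.
move=> free k S0.
(* [e b] is the form attaining the maximum for column b; with it the step is linear at f. *)
pose e (b : 'I_r) := if lc W nm f b <= lc W np f b then np else nm.
have e0 b : supported p (e b) by rewrite /e; case: ifP.
have maxE b : Order.max (lc W np f b) (lc W nm f b) = lc W (e b) f b.
  by rewrite /e; case: leP => h; rewrite /Order.max; case: ltP h.
(* A relation k on the new window, pulled back to the old one by the transpose of the step. *)
pose k' (c : 'I_r) (i : nat) : int :=
  (if i is i'.+1 then k c i' else - k c (p c).-1)
  + \sum_b k b (p b).-1 * (e b c b i)%:Z.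
have free' : \sum_c \sum_(i < p c) (k' c i)%:~R * f c i = 0.
  rewrite -[RHS]S0.
  transitivity (\sum_c (\sum_(i < p c) (if i : nat is i'.+1 then k c i' else - k c (p c).-1)%:~R * f c i
     + (k c (p c).-1)%:~R * lc W (e c) f c)).
    rewrite big_split /=.
    transitivity (\sum_c \sum_(i < p c) (if i : nat is i'.+1 then k c i' else - k c (p c).-1)%:~R * f c i
      + \sum_c \sum_(i < p c) \sum_b (k b (p b).-1)%:~R * ((e b c b i)%:R * f c i)).
      rewrite -big_split; apply: eq_bigr => c _; rewrite -big_split; apply: eq_bigr => i _ /=.
      rewrite /k' intrD mulrDl; congr (_ + _).
      rewrite rmorph_sum /= mulr_suml; apply: eq_bigr => b _.
      by rewrite intrM mulrA.
    congr (_ + _).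
    transitivity (\sum_c \sum_b \sum_(i < p c) (k b (p b).-1)%:~R * ((e b c b i)%:R * f c i)).
      by apply: eq_bigr => c _; rewrite exchange_big.
    rewrite exchange_big /=; apply: eq_bigr => b _.
    rewrite lc_window // mulr_sumr; apply: eq_bigr => c _.
    by rewrite mulr_sumr.
  apply: eq_bigr => c _.
  case Ep : (p c) (p_gt0 c) => [//|q] _ /=.
  rewrite big_ord_recl big_ord_recr /= /tropical /fwd Ep eqxx maxE.
  rewrite (_ : \sum_(i < q) (k c (bump 0 i).-1)%:~R * _ = \sum_(i < q) (k c i)%:~R * f c i.+1) //.
  rewrite (_ : \sum_(i < q) (k c i)%:~R * (if _ then _ else _) =
    \sum_(i < q) (k c i)%:~R * f c i.+1); last first.
    by apply: eq_bigr => i _; rewrite eqSS ltn_eqF.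
  rewrite rmorphN /=; ring.
have k'0 := free k' free'.
(* Supported forms do not involve entry 0, so its coefficient in [k'] is just minus the last
   coefficient of k; once these vanish, [k'] is k moved by one place. *)
have last0 c : k c (p c).-1 = 0.
  have := k'0 c 0%N (p_gt0 c); rewrite /k' big1 ?addr0; last first.
    by move=> b _; rewrite (e0 b) // mulr0.
  by move=> /eqP; rewrite oppr_eq0 => /eqP.
move=> c j jp; have [jl|jl] := eqVneq j.+1 (p c); first by rewrite -(last0 c) -jl.
have := k'0 c j.+1; rewrite ltn_neqAle jl jp => /(_ isT); rewrite /k' big1 ?addr0 //.
by move=> b _; rewrite last0 mul0r.
Qed.

Lemma tropical_iter_free f n : window_free f -> window_free (iter n tropical f).
Proof. by move=> f0; elim: n => //= n; apply: tropical_free. Qed.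

(** Freeness forces the coefficients n^+ - n^- to vanish, and equal coefficients with disjoint
    supports are zero. *)
Lemma lc_diff_neq0 f a : window_free f -> lc W np f a = lc W nm f a ->
  forall b k, np b a k = 0%N /\ nm b a k = 0%N.
Proof.
move=> free E b k.
have [/andP[_ kp]|kn] := boolP (0 < k < p b)%N; last by rewrite np0 // nm0.
have : (np b a k)%:Z - (nm b a k)%:Z = 0.
  apply: (free (fun b k => (np b a k)%:Z - (nm b a k)%:Z)) => //.
  have /eqP := E; rewrite -subr_eq0 !lc_window // -sumrB => /eqP E0.
  rewrite -[RHS]E0; apply: eq_bigr => c _; rewrite -sumrB; apply: eq_bigr => j _.
  by rewrite rmorphB /= mulrBl.
have := np_nm b a k; have [->|] := eqVneq (np b a k) 0%N; first lia.
have [->|] := eqVneq (nm b a k) 0%N; first lia.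
by rewrite -!lt0n => h1 h2; have := muln_gt0 (np b a k) (nm b a k); rewrite h1 h2 => /[swap] ->.
Qed.

Lemma exists_window_free : exists v : 'I_r -> nat -> R, window_free v.
Proof.
pose q (bk : nat * nat) := nth_prime (choice.pickle bk).
exists (fun b k => ln (q (nat_of_ord b, k))%:R) => k S0 b j jp.
pose q' (bj : 'I_r * 'I_W) := q (nat_of_ord bj.1, nat_of_ord bj.2).
pose k' (bj : 'I_r * 'I_W) := if (bj.2 < p bj.1)%N then k bj.1 bj.2 else 0.
have jW : (j < W)%N by apply: ltn_trans (pW b).
suff : k' (b, Ordinal jW) = 0 by rewrite /k' /= jp.
apply: (@ln_primes_free R _ q' k').
- move=> [b1 j1] [b2 j2] /nth_prime_inj /(pcan_inj choice.pickleK) [] /val_inj -> /val_inj -> //.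
- by move=> i; apply: prime_nth_prime.
- rewrite -[RHS]S0 -(pair_bigA _ (fun b j => (k' (b, j))%:~R * ln (q' (b, j))%:R)) /=.
  apply: eq_bigr => c _.
  rewrite (big_ord_widen W (fun j => (k c j)%:~R * ln (q (nat_of_ord c, j))%:R) (ltnW (pW c))).
  rewrite [RHS]big_mkcond /=; apply: eq_bigr => i _.
  by rewrite /k' /=; case: ifP => // _; rewrite mul0r.
Qed.

End Tropical.

(** * Comparison with the max-plus T-system at infinity *)

Section Asymptotics.
Variables (R : realType) (r W : nat) (p : 'I_r -> nat).
Hypotheses (p_gt0 : forall a, (0 < p a)%N) (pW : forall a, (p a < W)%N).
Variables (np nm : 'I_r -> 'I_r -> nat -> nat).
Hypotheses (np0 : supported p np) (nm0 : supported p nm).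
Hypothesis np_nm : forall b a k, (np b a k * nm b a k = 0)%N.

(** A common Lipschitz constant, in the sup norm, of the forms [lc] of [np] and [nm]. *)
Definition total_mass : R := \sum_a \sum_b \sum_(k < W) (np b a k + nm b a k)%:R.

Lemma total_mass_ge0 : 0 <= total_mass.
Proof. by do 3!(apply: sumr_ge0 => ? _). Qed.

Lemma lc_close n (f g : 'I_r -> nat -> R) c a : (n = np \/ n = nm) -> 0 <= c ->
  (forall b k, `|f b k - g b k| <= c) -> `|lc W n f a - lc W n g a| <= total_mass * c.
Proof.
move=> nn c0 fg.
apply: (@le_trans _ _ (\sum_b \sum_(k < W) (n b a k)%:R * c)).
  rewrite /lc -sumrB; apply: le_trans (ler_norm_sum _ _ _) _; apply: ler_sum => b _.
  rewrite -sumrB; apply: le_trans (ler_norm_sum _ _ _) _; apply: ler_sum => k _.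
  by rewrite -mulrBr normrM ger0_norm // ler_wpM2l.
rewrite /total_mass [X in _ <= X * _](bigD1 a) //= mulrDl mulr_suml.
apply: (@le_trans _ _ (\sum_(b < r) (\sum_(k < W) (np b a k + nm b a k)%:R) * c)).
  apply: ler_sum => b _; rewrite mulr_suml; apply: ler_sum => k _.
  by rewrite ler_wpM2r // ler_nat; case: nn => ->; rewrite ?leq_addr ?leq_addl.
by rewrite lerDl mulr_ge0 //; do 3!(apply: sumr_ge0 => ? _).
Qed.

Lemma lse_close x y x' y' (th e : R) : 0 <= th ->
  `|x - th * x'| <= e -> `|y - th * y'| <= e ->
  `|lse x y - th * Order.max x' y'| <= e + ln 2.
Proof.
move=> th0 hx hy.
have ln2 : 0 < ln 2 :> R by rewrite ln_gt0 // ltr1n.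
have h1 := lse_le_max x y; have h2 := ltW (lse_gtl x y); have h3 := ltW (lse_gtr x y).
rewrite maxr_pMr //.
move: hx hy; rewrite !ler_norml => /andP[a1 a2] /andP[b1 b2].
by apply/andP; split; move: h1; case: (leP x y); case: (leP (th * x') (th * y')); lra.
Qed.

Variables (t0 : 'I_r -> R) (v : 'I_r -> nat -> R).

Local Notation line := (ray (fun a _ => t0 a) v).

(** One step multiplies the error by a fixed factor and adds ln 2, the gap between lse and max. The
    constant depends on n but not on th, so it is negligible against th at infinity. *)
Lemma iter_fwd_close n : exists c, 0 <= c /\ forall th a k, 0 <= th ->
  `|iter n (fwd W p np nm (@lse R)) (line th) a k
    - th * iter n (fwd W p np nm (@Order.max _ R)) v a k| <= c.
Proof.
elim: n => [|n [c [c0 IH]]] /=.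
  exists (\sum_a `|t0 a|); split; first exact: sumr_ge0.
  by move=> th a k _; rewrite /ray addrK (bigD1 a) //= lerDl sumr_ge0.
exists (total_mass * c + ln 2 + c).
have ln2 : 0 < ln 2 :> R by rewrite ln_gt0 // ltr1n.
have Sc0 : 0 <= total_mass * c by rewrite mulr_ge0 // total_mass_ge0.
split=> [|th a k th0]; first by rewrite !addr_ge0 // ltW.
rewrite {1}/fwd [in X in _ - _ * X]/fwd; case: eqP => _; last first.
  by apply: le_trans (IH th a k.+1 th0) _; rewrite lerDr addr_ge0 // ltW.
set f := iter n _ (line th); set g := iter n _ v.
have lcZ m : lc W m (fun b k => th * g b k) a = th * lc W m g a.
  rewrite /lc mulr_sumr; apply: eq_bigr => b _.
  by rewrite mulr_sumr; apply: eq_bigr => j _; rewrite mulrCA.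
have hp := @lc_close np f (fun b k => th * g b k) c a (or_introl erefl) c0 (fun b k => IH th b k th0).
have hm := @lc_close nm f (fun b k => th * g b k) c a (or_intror erefl) c0 (fun b k => IH th b k th0).
rewrite !lcZ in hp hm.
have h := lse_close th0 hp hm.
rewrite [X in `|X|](_ : _ =
  (lse (lc W np f a) (lc W nm f a) - th * Order.max (lc W np g a) (lc W nm g a))
  - (f a 0%N - th * g a 0%N)); last by ring.
by apply: le_trans (ler_normB _ _) _; rewrite lerD // IH.
Qed.

Local Notation sol_lse th := (sol W p np nm (@lse R) (line th)).

Lemma ylog_close a u : exists c, forall th, 0 <= th ->
  `|ylog W np nm (sol_lse th) a u
    - th * ylog W np nm (sol W p np nm (@Order.max _ R) v) a u| <= c.
Proof.
have [c [c0 H]] := iter_fwd_close u; exists (total_mass * c + total_mass * c) => th th0.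
have E F f n : supported p n -> lc W n (fun b k => sol W p np nm F f b (u + k)) a =
    lc W n (iter u (fwd W p np nm F) f) a.
  by move=> n0; apply: eq_lc n0 _ => b k /andP[_ lk]; apply: solD.
rewrite /ylog !E //.
set f := iter u _ (line th); set g := iter u _ v.
have lcZ m : lc W m (fun b k => th * g b k) a = th * lc W m g a.
  rewrite /lc mulr_sumr; apply: eq_bigr => b _.
  by rewrite mulr_sumr; apply: eq_bigr => j _; rewrite mulrCA.
have hp := @lc_close np f (fun b k => th * g b k) c a (or_introl erefl) c0 (fun b k => H th b k th0).
have hm := @lc_close nm f (fun b k => th * g b k) c a (or_intror erefl) c0 (fun b k => H th b k th0).
rewrite !lcZ in hp hm.
rewrite [X in `|X|](_ : _ =
  (lc W np f a - th * lc W np g a) - (lc W nm f a - th * lc W nm g a)); last by ring.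
by apply: le_trans (ler_normB _ _) _; rewrite lerD.
Qed.

Hypothesis v_free : window_free p v.

(** The sign of the tropical value Y decides: y tends to -oo, giving m = 2, or to +oo, giving m = 0.
    If Y = 0, column a of both matrices is zero, y vanishes identically and m = 1. *)
Lemma cvg_rogers_logistic_ylog a u : exists m : nat,
  rogers_logistic (ylog W np nm (sol_lse th) a u) @[th --> +oo] --> (pi ^+ 2 / 12 * m%:R : R).
Proof.
set Y := ylog W np nm (sol W p np nm (@Order.max _ R) v) a u.
have [c Hc] := ylog_close a u; rewrite -/Y in Hc.
have [Y0|Y0|Y0] := ltgtP Y 0.
- exists 2%N; rewrite (_ : pi ^+ 2 / 12 * 2%:R = pi ^+ 2 / 6); last by field.
  apply: (@cvg_comp _ _ _ (fun th => ylog W np nm (sol_lse th) a u) _ _ (ninfty_nbhs R)); last first.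
    exact: cvgNy_rogers_logistic.
  apply/cvgrNyPle => A; near=> th.
  have th0 : 0 <= th by near: th; apply: nbhs_pinfty_ge.
  have := Hc th th0; rewrite ler_norml => /andP[_]; rewrite lerBlDr => h; apply: le_trans h _.
  by rewrite -lerBrDl -ler_ndivrMr.
- exists 0%N; rewrite mulr0.
  apply: (@cvg_comp _ _ _ (fun th => ylog W np nm (sol_lse th) a u) _ _ (pinfty_nbhs R)); last first.
    exact: cvgy_rogers_logistic.
  apply/cvgryPge => A; near=> th.
  have th0 : 0 <= th by near: th; apply: nbhs_pinfty_ge.
  have := Hc th th0; rewrite ler_norml => /andP[h _]; rewrite lerBrDr in h; apply: le_trans h.
  by rewrite -lerBlDl opprK -ler_pdivrMr.
- exists 1%N; rewrite mulr1.
  have col0 b k : np b a k = 0%N /\ nm b a k = 0%N.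
    have E n : supported p n -> lc W n (fun b k => sol W p np nm (@Order.max _ R) v b (u + k)) a =
        lc W n (iter u (fwd W p np nm (@Order.max _ R)) v) a.
      by move=> n0; apply: eq_lc n0 _ => c' k' /andP[_ lk]; apply: solD.
    have free_u := @tropical_iter_free _ _ _ _ p_gt0 pW _ _ np0 nm0 _ u v_free.
    apply: (lc_diff_neq0 pW np0 nm0 np_nm free_u _ b k).
    by apply/eqP; rewrite -subr_eq0 -!E // -Y0.
  have -> : (fun th => rogers_logistic (ylog W np nm (sol_lse th) a u)) = fun=> pi ^+ 2 / 12.
    apply/funext => th; rewrite -rogers_logistic0; congr rogers_logistic.
    have lc0 n f : (forall b k, n b a k = 0%N) -> lc W n f a = 0 :> R.
      by move=> n0; rewrite /lc big1 // => b _; rewrite big1 // => k _; rewrite n0 mul0r.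
    by rewrite /ylog !lc0 ?subrr // => b k; have [] := col0 b k.
  exact: cvg_cst.
Unshelve. all: by end_near. Qed.

End Asymptotics.

Section CvgSum.

Lemma cvg_sum_ord (R : realType) n (f : 'I_n -> R -> R) (l : 'I_n -> R) (F : set_system R) :
  Filter F -> (forall i, f i @ F --> l i) -> (fun x => \sum_i f i x) @ F --> \sum_i l i.
Proof.
move=> FF H; elim: n f l H => [|n IH] f l H.
  by rewrite big_ord0; under eq_fun do rewrite big_ord0; exact: cvg_cst.
rewrite big_ord_recl; under eq_fun do rewrite big_ord_recl.
by apply: cvgD; [exact: H|apply: IH => i; exact: H].
Qed.

End CvgSum.

(** * Rationality of the dilogarithm sum *)

Section Rationality.
Variables (R : realType) (r W : nat) (p : 'I_r -> nat).
Hypotheses (p_gt0 : forall a, (0 < p a)%N) (pW : forall a, (p a < W)%N).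
Variables (np nm : 'I_r -> 'I_r -> nat -> nat).
Hypotheses (np0 : supported p np) (nm0 : supported p nm).
Hypothesis np_nm : forall b a k, (np b a k * nm b a k = 0)%N.
Variable Om : nat.
Hypotheses (Om_gt0 : (0 < Om)%N) (Om_per : fwd_periodic W p np nm (@lse R) Om).
Variable d : 'I_r -> int.
Hypothesis symp : symplectic_coef W p np nm (fun a => (d a)%:~R : R).

(** At x = 0 the ray starts from the constant solution, where the conserved sum is Om times the
    wanted one; at infinity it is an integer multiple of pi^2/12. *)
Theorem rational_dilog_sum (t : 'I_r -> R) : constant_solution W np nm t ->
  exists q : rat, 6 / pi ^+ 2 *
    (\sum_a (d a)%:~R * rogers_logistic (lcc W np t a - lcc W nm t a)) = ratr q.
Proof.
move=> t_sol; have [v v_free] := exists_window_free R pW.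
pose Phi := dilog_sum W p np nm Om (fun a => (d a)%:~R) (fun a _ => t a) v.
have [m Hm] := choice (fun ua : nat * 'I_r =>
  cvg_rogers_logistic_ylog p_gt0 pW np0 nm0 np_nm t v_free ua.2 ua.1).
set S := \sum_a _.
have Phi0 : Phi 0 = Om%:R * S.
  have const n : iter n (fwd W p np nm (@lse R)) (ray (fun a _ => t a) v 0) = fun a _ => t a.
    elim: n => [|n IH] /=.
      by apply/funext => a; apply/funext => k; rewrite /ray mul0r addr0.
    rewrite IH; apply/funext => a; apply/funext => k; rewrite /fwd; case: eqP => // _.
    by rewrite -t_sol mulr_natl mulr2n addrK.
  have lcE n a u : lc W n (fun b k => sol W p np nm (@lse R) (ray (fun a _ => t a) v 0) b (u + k)%N) a
      = lcc W n t a.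
    by apply: eq_bigr => b _; apply: eq_bigr => k _; rewrite /sol const.
  rewrite /Phi /dilog_sum (eq_bigr (fun=> S)) => [|u _].
    by rewrite sumr_const card_ord mulr_natl.
  by apply: eq_bigr => a _; rewrite /ylog !lcE.
have Phi_lim : Phi @ +oo --> \sum_(u < Om) \sum_a (d a)%:~R * (pi ^+ 2 / 12 * (m (nat_of_ord u, a))%:R : R).
  apply: cvg_sum_ord => u; apply: cvg_sum_ord => a.
  by apply: cvgZr; apply: (Hm (nat_of_ord u, a)).
have E : Om%:R * S = \sum_(u < Om) \sum_a (d a)%:~R * (pi ^+ 2 / 12 * (m (nat_of_ord u, a))%:R).
  rewrite -Phi0; move: Phi_lim; have -> : Phi = fun=> Phi 0.
    by apply/funext => x; apply: dilog_sum_constant.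
  by move=> /(cvg_lim (@Rhausdorff R)); rewrite lim_cst.
pose N : int := \sum_(u < Om) \sum_a d a * (m (nat_of_ord u, a))%:Z.
have EN : Om%:R * S = pi ^+ 2 / 12 * N%:~R.
  rewrite E /N rmorph_sum mulr_sumr; apply: eq_bigr => u _.
  rewrite rmorph_sum mulr_sumr; apply: eq_bigr => a _.
  by rewrite rmorphM /= mulrCA mulrA.
(* The 2 comes from 6/pi^2 times pi^2/12, and [Om] from the number of summed times. *)
exists (N%:~R / (2 * Om%:R)).
have p0 : pi != 0 :> R by rewrite gt_eqF // pi_gt0.
have Om0 : Om%:R != 0 :> R by rewrite pnatr_eq0 -lt0n.
rewrite fmorph_div /= rmorphM /= ratr_int !ratr_nat.
have alg (P M s n : R) : P != 0 -> M != 0 -> M * s = P ^+ 2 / 12 * n ->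
    6 / P ^+ 2 * s = n / (2 * M).
  move=> P0 M0 e; apply: (mulfI M0); rewrite mulrCA e.
  by field; rewrite P0 M0.
exact: alg.
Qed.

End Rationality.

(** * The Nahm system *)

Section NahmSystem.
Variables (R : realType) (r W : nat) (p : 'I_r -> nat).
Hypothesis pW : forall a, (p a < W)%N.
Variables (np nm : 'I_r -> 'I_r -> nat -> nat).
Variable d : 'I_r -> R.
Hypothesis d_gt0 : forall a, 0 < d a.
Hypothesis symp : symplectic_coef W p np nm d.

Definition Amx n : 'M[R]_r := \matrix_(b, a) \sum_(i < W) Acoef R p n b a i.

Lemma mul_Amx n (x : 'rV[R]_r) a :
  (x *m Amx n) 0 a = 2 * x 0 a - lcc W n (fun b => x 0 b) a.
Proof.
have := AopE pW n (fun b _ => x 0 b) a 0.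
rewrite /Aop /lcc mulr_natl mulr2n => ->.
rewrite mxE; apply: eq_bigr => b _; rewrite mxE mulrC mulr_suml.
by apply: eq_bigr => i _.
Qed.

Variable l : 'I_r -> R.
Hypotheses (l_gt0 : forall a, 0 < l a)
  (lp : forall a, lcc W np l a < 2 * l a) (lm : forall a, lcc W nm l a < 2 * l a).

(** For x in the left kernel, x and - x both satisfy the hypothesis of [max_principle], whence x =
    0. *)
Lemma Amx_unit n : n = np \/ n = nm -> Amx n \in unitmx.
Proof.
move=> nn; rewrite -row_free_unit; apply: inj_row_free => x x0.
have E (c : R) a : 2 * (c * x 0 a) = lcc W n (fun b => c * x 0 b) a.
  rewrite lccZ; have := mul_Amx n x a; rewrite x0 mxE => /esym/eqP.
  by rewrite subr_eq0 => /eqP <-; rewrite mulrCA.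
have H c a : c * x 0 a <= 0.
  apply: (max_principle l_gt0 lp lm (d := fun b => c * x 0 b)) => {}a.
  by rewrite E le_max; case: nn => ->; rewrite lexx ?orbT.
apply/rowP => a; rewrite mxE; apply/eqP; rewrite eq_le.
by have := H 1 a; have := H (-1) a; rewrite mul1r mulN1r oppr_le0 => -> ->.
Qed.

Let Rp := Amx np.
Let Rm := Amx nm.
Let D := diag_mx (\row_a d a).

(** The constant test function 1 evaluates the symplectic relation at z = 1. *)
Lemma Amx_symmetric : Rm *m D *m Rp^T = Rp *m D *m Rm^T.
Proof.
apply/matrixP => b c; have := symp b c (fun=> 1).
under eq_bigr do under eq_bigr do rewrite mulr1.
move=> E; apply/eqP; rewrite -subr_eq0 -{}E; apply/eqP.
have H n n' : (Amx n *m D *m (Amx n')^T) b c =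
    \sum_(i < W) \sum_(j < W) \sum_a d a * (Acoef R p n b a i * Acoef R p n' c a j).
  rewrite mxE; under eq_bigr => a _.
    rewrite mul_mx_diag !mxE mulrAC mulr_suml mulr_suml.
    under eq_bigr do rewrite mulr_sumr mulr_suml.
    over.
  rewrite exchange_big; apply: eq_bigr => i _.
  rewrite exchange_big; apply: eq_bigr => j _.
  by apply: eq_bigr => a _; rewrite mulrC.
rewrite !H -sumrB; apply: eq_bigr => i _; rewrite -sumrB; apply: eq_bigr => j _.
by rewrite -sumrB; apply: eq_bigr => a _; rewrite (mulrBr (d a)).
Qed.

Lemma D_unit : D \in unitmx.
Proof.
rewrite unitmxE det_diag unitfE; apply/prodf_neq0 => a _.
by rewrite mxE gt_eqF.
Qed.

(** The symmetry reads K D = D K^T, so conjugating by D transposes K. The Nahm exponents thus act on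
    the row vector of the ln(1 - f_b) as right multiplication by K. *)
Lemma Kcheck_tr : (invmx D *m (invmx Rp *m Rm) *m D)^T = invmx Rp *m Rm.
Proof.
have up : Rp \in unitmx by apply: Amx_unit; left.
have uD := D_unit.
have Dt : D^T = D by rewrite tr_diag_mx.
have e1 : D *m Rm^T = invmx Rp *m (Rm *m D *m Rp^T).
  by rewrite Amx_symmetric -!mulmxA mulKmx.
rewrite !trmx_mul !trmx_inv Dt !mulmxA e1 !mulmxA.
by rewrite mulmxK ?unitmx_tr // mulmxK.
Qed.

Definition nahm_system (kappa : 'M[R]_r) (f : 'rV[R]_r) :=
  (forall a, 0 < f 0 a < 1) /\
  (forall a, f 0 a = \prod_(b < r) (1 - f 0 b) `^ kappa a b).

Lemma ln_prod_gt0 (I : finType) (F : I -> R) : (forall i, 0 < F i) ->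
  0 < \prod_i F i /\ ln (\prod_i F i) = \sum_i ln (F i).
Proof.
move=> F0; pose K (x y : R) := 0 < x /\ ln x = y.
rewrite -/(K (\prod_i F i) (\sum_i ln (F i))).
elim/big_ind2: _ => [|x1 y1 x2 y2 [x10 <-] [x20 <-]|i _].
- by split; rewrite ?ln1.
- by split; rewrite ?mulr_gt0 // lnM.
- by split.
Qed.

Let kappa := invmx D *m (invmx Rp *m Rm) *m D.

Definition nahm_of_log (t : 'I_r -> R) : 'rV[R]_r :=
  \row_a logistic (lcc W np t a - lcc W nm t a).

(** In logarithms the system is ln f = X K with X = ln(1 - f). For t = - X A_+^-1 one gets t A_+ = -
    ln(1 - f) and t A_- = - ln f, and (1 - f) + f = 1 becomes the constant T-system. The converse
    reads the same identities backwards. *)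
Lemma nahm_systemP (f : 'rV[R]_r) : nahm_system kappa f <->
  exists2 t, constant_solution W np nm t & f = nahm_of_log t.
Proof.
have up : Rp \in unitmx by apply: Amx_unit; left.
have prodE (f' : 'rV[R]_r) a : (forall b, 0 < f' 0 b < 1) ->
   0 < \prod_(b < r) (1 - f' 0 b) `^ kappa a b /\
   ln (\prod_(b < r) (1 - f' 0 b) `^ kappa a b) =
     ((\row_b ln (1 - f' 0 b)) *m (invmx Rp *m Rm)) 0 a.
  move=> f01; have [] := @ln_prod_gt0 _ (fun b => (1 - f' 0 b) `^ kappa a b).
    by move=> b; rewrite powR_gt0 // subr_gt0; have /andP[] := f01 b.
  move=> h ->; split => //; rewrite -Kcheck_tr mxE; apply: eq_bigr => b _.
  by rewrite ln_powR !mxE mulrC.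
split=> [[f01 fE]|[t t_sol ->]].
  pose X : 'rV[R]_r := \row_b ln (1 - f 0 b).
  pose t : 'rV[R]_r := - (X *m invmx Rp).
  have tp a : 2 * t 0 a - lcc W np (fun b => t 0 b) a = - ln (1 - f 0 a).
    by rewrite -mul_Amx /t mulNmx mulmxKV // !mxE.
  have tm a : 2 * t 0 a - lcc W nm (fun b => t 0 b) a = - ln (f 0 a).
    rewrite -mul_Amx /t mulNmx -mulmxA mxE; congr (- _).
    by rewrite [in RHS]fE; have [_ ->] := prodE f a f01.
  have fa a : 0 < f 0 a /\ 0 < 1 - f 0 a by have := f01 a; rewrite subr_gt0 => /andP.
  have ep a : expR (lcc W np (fun b => t 0 b) a) = expR (2 * t 0 a) * (1 - f 0 a).
    have -> : lcc W np (fun b => t 0 b) a = 2 * t 0 a + ln (1 - f 0 a).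
      by have := tp a; lra.
    by rewrite expRD lnK // posrE; have [] := fa a.
  have em a : expR (lcc W nm (fun b => t 0 b) a) = expR (2 * t 0 a) * f 0 a.
    have -> : lcc W nm (fun b => t 0 b) a = 2 * t 0 a + ln (f 0 a).
      by have := tm a; lra.
    by rewrite expRD lnK // posrE; have [] := fa a.
  exists (fun b => t 0 b).
    by move=> a; rewrite /lse ep em -mulrDr subrK mulr1 expRK.
  apply/rowP => a; rewrite mxE /logistic expRD expRN ep em.
  have := expR_gt0 (2 * t 0 a); have [] := fa a => f0 f1 e0.
  by field; rewrite (gt_eqF f0) (gt_eqF e0) (addrC (f 0 a)) subrK oner_eq0.
set g := nahm_of_log t.
have f01 a : 0 < g 0 a < 1 by rewrite mxE logistic_bounds.
split=> // a; have [P0 PE] := prodE g a f01.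
apply: ln_inj; rewrite ?posrE //; first by have /andP[] := f01 a.
rewrite {}PE.
have XE : \row_b ln (1 - g 0 b) = - ((\row_b t b) *m Rp).
  apply/rowP => b; rewrite mxE [RHS]mxE mul_Amx !mxE ln_1logistic.
  have -> : lcc W np (fun b => (\row_b t b) 0 b) b = lcc W np t b.
    by congr (lcc _ _ _ _); apply/funext => c; rewrite mxE.
  by rewrite t_sol [lse (lcc _ _ _ _) _]lseC [lse (lcc _ _ _ _) _]lseE addrK opprB.
rewrite XE mulNmx mulmxA mulmxK // [RHS]mxE mul_Amx !mxE ln_logistic; congr (- _).
have -> : lcc W nm (fun b => (\row_b t b) 0 b) a = lcc W nm t a.
  by congr (lcc _ _ _ _); apply/funext => c; rewrite mxE.
by rewrite t_sol [lse (lcc _ _ _ _) _]lseE addrK.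
Qed.

Lemma nahm_system_unique : exists! f, nahm_system kappa f.
Proof.
have [t t_sol] := constant_solution_exists l_gt0 lp lm.
exists (nahm_of_log t); split; first by apply/nahm_systemP; exists t.
move=> f /nahm_systemP [s s_sol ->]; congr nahm_of_log; apply/funext.
exact: (constant_solution_unique l_gt0 lp lm).
Qed.

End NahmSystem.

(** * T-data *)

Lemma sum_pair (S : zmodType) (I J : finType) (F : I * J -> S) :
  \sum_x F x = \sum_i \sum_j F (i, j).
Proof. by rewrite (pair_bigA _ (fun i j => F (i, j))); apply: eq_bigr => -[]. Qed.

(** * From Laurent identities to coefficients *)

Section LaurentIdentities.

Lemma zL_neq0 : zL != 0.
Proof. by rewrite /zL -(rmorph0 (@FracField.tofrac {poly int})) tofrac_eq polyX_eq0. Qed.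

(** The relation makes the total coefficient of each power vanish, so z^e may be replaced by any
    function of e. *)
Lemma laurent_functional (S : nzRingType) (I : finType) (c : I -> int) (e : I -> nat) (psi : nat -> S) :
  \sum_i (c i)%:~R * zL ^+ e i = 0 -> \sum_i (c i)%:~R * psi (e i) = 0.
Proof.
move=> S0.
have P0 : \sum_i (c i)%:P * 'X^(e i) = 0 :> {poly int}.
  apply/eqP; rewrite -tofrac_eq rmorph0 rmorph_sum /= -[X in _ == X]S0; apply/eqP.
  apply: eq_bigr => i _; rewrite rmorphM rmorphXn /=; congr (_ * _).
  have -> : (c i)%:P = (c i)%:~R :> {poly int} by rewrite -[in LHS](intz (c i)) rmorph_int.
  by rewrite rmorph_int.
pose M := (\max_i e i).+1.
have eM i : (e i < M)%N by rewrite ltnS; apply: leq_bigmax.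
transitivity (\sum_(k < M) (\sum_i c i * (k == e i :> nat)%:R)%:~R * psi k).
  under [RHS]eq_bigr do rewrite rmorph_sum /= mulr_suml.
  rewrite exchange_big; apply: eq_bigr => i _ /=.
  rewrite (bigD1 (Ordinal (eM i))) //= eqxx mulr1 big1 ?addr0 // => k.
  by rewrite -val_eqE /= => /negPf ->; rewrite mulr0 mul0r.
apply: big1 => k _; have := congr1 (fun q : {poly int} => q`_k) P0.
rewrite coef0 coef_sum.
by under eq_bigr do rewrite coefCM coefXn; move=> ->; rewrite mul0r.
Qed.

Lemma peval_sum (F : fieldType) (x : F) (q : {poly int}) n : (size q <= n)%N ->
  peval x q = \sum_(i < n) (q`_i)%:~R * x ^+ i.
Proof.
move=> qn; rewrite /peval (@horner_coef_wide _ n); last first.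
  exact: leq_trans (size_poly _ _) qn.
by apply: eq_bigr => i _; rewrite coef_map_id0.
Qed.

Lemma zL_expVB i n : (i <= n)%N -> zL ^+ n * zL^-1 ^+ i = zL ^+ (n - i).
Proof. by move=> h; rewrite exprVn expfB_cond // (negPf zL_neq0). Qed.

End LaurentIdentities.

(** * Cartan-like T-data as real T-systems *)

Section CartanData.
Variables (r : nat) (alpha : Tdatum r).

Definition width := (\max_a tp alpha a).+1.

Lemma tp_width a : (tp alpha a < width)%N.
Proof. by rewrite ltnS; apply: leq_bigmax. Qed.

Definition expo (N : 'M[{poly int}]_r) (b a : 'I_r) (k : nat) : nat := absz ((N b a)`_k).

Lemma supported_Nplus : supported (tp alpha) (expo (Nplus alpha)).
Proof. by move=> b a k /(@Nplus_supp _ alpha b a k); rewrite /expo => ->. Qed.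

Lemma supported_Nminus : supported (tp alpha) (expo (Nminus alpha)).
Proof. by move=> b a k /(@Nminus_supp _ alpha b a k); rewrite /expo => ->. Qed.

Lemma expo_disjoint b a k : (expo (Nplus alpha) b a k * expo (Nminus alpha) b a k = 0)%N.
Proof. by rewrite /expo -abszM Nplus_Nminus. Qed.

Lemma size_N0 b a : (size (N0 alpha b a) <= width)%N.
Proof.
apply/leq_sizeP => j jW; have pj := leq_trans (tp_width b) jW.
by rewrite N0E (gtn_eqF pj) (gtn_eqF (leq_ltn_trans (leq0n _) pj)) !andbF addr0.
Qed.

Lemma size_supported N b a : supported (tp alpha) (expo N) -> (size (N b a) <= width)%N.
Proof.
move=> sN; apply/leq_sizeP => j jW; apply/eqP; rewrite -absz_eq0; apply/eqP.
by apply: (sN b a j); have := tp_width b; lia.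
Qed.

Hypothesis cartan_alpha : Cartan_like alpha.

Lemma PA_E w (A : 'M[{poly int}]_r) b a :
  PA alpha w A b a = w ^- tp alpha b * peval (w ^+ 2) (A b a).
Proof. by rewrite /PA mul_diag_mx mxE mxE [X in _ * X]mxE. Qed.

(** A diagonal entry q of A_+ satisfies z^p q(1/z) = q(z), so its coefficients at 0 and p agree; the
    first is 1, and the second is 1 only if sigma fixes a. *)
Lemma Cartan_like_sigma a : tsigma alpha a = a.
Proof.
have [/matrixP/(_ a a) + _] := cartan_alpha.
have z0 := zL_neq0; have pW := tp_width a; set p := tp alpha a in pW *.
set q := Aplus alpha a a.
have sq : (size q <= width)%N.
  by rewrite /q mxE (leq_trans (size_polyD _ _)) // geq_max size_N0 /= mxE size_polyN
    size_supported //; apply: supported_Nplus.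
have q0 : q`_0 = 1.
  by rewrite /q !mxE coefB N0E eqxx Nplus_supp // (ltn_eqF (tp_gt0 _ _)) andbF subr0 addr0.
have qp : q`_p = (a == tsigma alpha a)%:R.
  by rewrite /q !mxE coefB N0E !eqxx Nplus_supp ?ltnn ?andbF // (gtn_eqF (tp_gt0 _ _)) andbT add0r subr0.
rewrite !PA_E -/p -/q !(peval_sum _ sq) => E.
(* The invariance is multiplied by zL^(p + 2 width) to clear negative powers; exponents are doubled
   because [zL] stands for z^(1/2), and [true] marks the side moved over with a minus sign. Testing
   at exponent 2 width isolates q_0 and q_p. *)
pose c (x : bool * 'I_width) : int := (-1) ^+ x.1 * q`_x.2.
pose e (x : bool * 'I_width) : nat :=
  if x.1 then (width.*2 + x.2.*2)%N else (p.*2 + (width - x.2).*2)%N.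
have pairE (S : zmodType) (F : bool * 'I_width -> S) :
    \sum_x F x = \sum_(i < width) F (true, i) + \sum_(i < width) F (false, i).
  by rewrite sum_pair big_bool.
have := @laurent_functional int _ c e (fun k => (k == width.*2)%:R).
rewrite !pairE => H.
have shuffle (S : comNzRingType) (x y v w : S) :
    v * (x * x * (y * w)) = x * y * (x * (v * w)) by ring.
have cancel_shuffle (F : fieldType) (x y v w : F) : x != 0 ->
    x * y * (x^-1 * (v * w)) = v * (y * w).
  by move=> x0; field.
have pick j : (j < width)%N -> \sum_(i < width) q`_i * (i == j :> nat)%:R = q`_j.
  move=> jW; rewrite (bigD1 (Ordinal jW)) //= eqxx mulr1 big1 ?addr0 // => i.
  by rewrite -val_eqE /= => /negPf ->; rewrite mulr0.
have : - q`_0 + q`_p = 0.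
  rewrite -[RHS]H; last first.
    rewrite /c /e /=; under eq_bigr do rewrite mulN1r rmorphN mulNr.
    under [X in _ + X]eq_bigr do rewrite mul1r.
    rewrite sumrN; apply/eqP; rewrite addrC subr_eq0; apply/eqP.
    transitivity (zL ^+ p * zL ^+ width.*2 *
        (zL^-1 ^- p * (\sum_(i < width) (q`_i)%:~R * zL^-1 ^+ 2 ^+ i))).
      rewrite !mulr_sumr; apply: eq_bigr => i _.
      rewrite -exprM mul2n exprVn invrK doubleB exprD -zL_expVB ?leq_double 1?ltnW //.
      by rewrite -(addnn p) exprD; apply: shuffle.
    rewrite E !mulr_sumr; apply: eq_bigr => i _; rewrite -exprM mul2n exprD.
    exact/cancel_shuffle/expf_neq0.
  rewrite -(pick 0%N) // -(pick p) // -sumrN /c /e /=; congr (_ + _); apply: eq_bigr => i _.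
    rewrite mulN1r intz mulNr; congr (- (_ * _%:R)); lia.
  rewrite mul1r intz; congr (_ * _%:R).
  have := ltn_ord i; lia.
rewrite q0 qp; case: eqP => // ->; lia.
Qed.

Lemma N0_coef b a k : (N0 alpha b a)`_k = ((b == a) * ((k == 0%N) + (k == tp alpha b)))%N%:R.
Proof.
rewrite N0E Cartan_like_sigma; case: (b == a); rewrite ?mul0n ?addr0 //=.
by rewrite mul1n natrD.
Qed.

Lemma A_coef (S : realFieldType) (N : 'M[{poly int}]_r) b a k :
  (forall b a (k : nat), 0 <= (N b a)`_k) ->
  (((N0 alpha - N) b a)`_k)%:~R = Acoef S (tp alpha) (expo N) b a k.
Proof.
move=> N_ge0; rewrite !mxE coefB N0_coef rmorphB /= /Acoef; congr (_ - _).
  by rewrite rmorph_nat natrM natrD.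
by rewrite /expo -[in LHS](gez0_abs (N_ge0 b a k)).
Qed.

Variable R : realType.

Let W := width.
Let p := tp alpha.
Let np := expo (Nplus alpha).
Let nm := expo (Nminus alpha).
Let d a : R := (td alpha 0 a)%:~R.

(** Multiplied by z^W, an entry of the symplectic relation has only the nonnegative exponents i + (W
    - j), and [laurent_functional] applies. *)
Lemma Tdatum_symplectic_coef : symplectic_coef W p np nm d.
Proof.
move=> b c psi.
pose C (x : 'I_r * ('I_W * 'I_W)) : int := td alpha 0 x.1 *
  ((Aminus alpha b x.1)`_x.2.1 * (Aplus alpha c x.1)`_x.2.2
   - (Aplus alpha b x.1)`_x.2.1 * (Aminus alpha c x.1)`_x.2.2).
pose e (x : 'I_r * ('I_W * 'I_W)) := (x.2.1 + (W - x.2.2))%N.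
have sizeA (N : 'M[{poly int}]_r) a' b' : supported p (expo N) -> (size ((N0 alpha - N)%R b' a') <= W)%N.
  move=> sN; rewrite mxE (leq_trans (size_polyD _ _)) // geq_max size_N0 /= mxE size_polyN.
  exact: size_supported.
have shuffle (S : comNzRingType) (n x y v w z : S) :
    n * (x * y * z * (v * w)) = z * (x * v) * (y * (n * w)) by ring.
have entry (A B : 'M[{poly int}]_r) : (forall a' b', size (A b' a') <= W)%N ->
    (forall a' b', size (B b' a') <= W)%N ->
    zL ^+ W * (mxeval zL A *m intdiag _ (td alpha) *m dagger B) b c =
    \sum_a \sum_(i < W) \sum_(j < W) (td alpha 0 a * ((A b a)`_i * (B c a)`_j))%:~R * zL ^+ (i + (W - j)).
  move=> sA sB; rewrite mxE mulr_sumr; apply: eq_bigr => a _.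
  rewrite mul_mx_diag !mxE (peval_sum _ (sA a b)) (peval_sum _ (sB a c)).
  rewrite !mulr_suml mulr_sumr; apply: eq_bigr => i _; rewrite !mulr_sumr; apply: eq_bigr => j _.
  rewrite exprD -(zL_expVB (ltnW (ltn_ord j))) !intrM; apply: shuffle.
have := @laurent_functional R _ C e psi.
have tripE (S : zmodType) (F : 'I_r * ('I_W * 'I_W) -> S) :
    \sum_x F x = \sum_a \sum_(i < W) \sum_(j < W) F (a, (i, j)).
  by rewrite sum_pair; apply: eq_bigr => a _; rewrite sum_pair.
rewrite !tripE => H.
transitivity (\sum_a \sum_(i < W) \sum_(j < W) (C (a, (i, j)))%:~R * psi (e (a, (i, j)))); last first.
  apply: H.
  have /matrixP/(_ b c)/(congr1 (fun x => zL ^+ W * x)) := symplectic_D alpha.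
  rewrite !entry; try by move=> *; apply: sizeA; (exact: supported_Nplus || exact: supported_Nminus).
  move=> /esym/eqP; rewrite -subr_eq0 -sumrB => /eqP E; rewrite -[RHS]E.
  apply: eq_bigr => a _; rewrite -sumrB; apply: eq_bigr => i _; rewrite -sumrB; apply: eq_bigr => j _.
  by rewrite /C /e /= mulrBr rmorphB /= mulrBl.
rewrite [RHS]exchange_big; apply: eq_bigr => i _.
rewrite [RHS]exchange_big; apply: eq_bigr => j _.
rewrite mulr_suml; apply: eq_bigr => a _; rewrite /C /e /=; congr (_ * _).
rewrite intrM rmorphB /= !intrM; congr (_ * (_ * _ - _ * _)); rewrite A_coef //;
  by [exact: Nplus_ge0 | exact: Nminus_ge0].
Qed.

Let expR_sum (I : Type) (s : seq I) (F : I -> R) :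
  expR (\sum_(i <- s) F i) = \prod_(i <- s) expR (F i).
Proof. exact: (big_morph _ (@expRD R) (@expR0 R)). Qed.

Lemma Tmon_expR (t : 'I_r -> int -> R) (N : 'M[{poly int}]_r) a u :
  (forall b, size (N b a) <= W)%N ->
  Tmon (fun a u => expR (t a u)) N a u = expR (lc W (expo N) (fun b k => t b (u + k%:Z)) a).
Proof.
move=> sN; rewrite expR_sum; apply: eq_bigr => b _; rewrite expR_sum.
rewrite (big_ord_widen W (fun k => expR (t b (u + k%:Z)) ^+ absz ((N b a)`_k)) (sN b)).
rewrite big_mkcond; apply: eq_bigr => k _ /=.
rewrite expRM_natl /expo; case: ltnP => // h.
by rewrite [(N b a)`_k]nth_default.
Qed.

Lemma lc_N0 (f : 'I_r -> nat -> R) a :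
  lc W (expo (N0 alpha)) f a = f a 0%N + f a (p a).
Proof.
have pick j : (j < W)%N -> \sum_(k < W) (k == j :> nat)%:R * f a k = f a j.
  move=> jW; rewrite (bigD1 (Ordinal jW)) //= eqxx mul1r big1 ?addr0 // => i.
  by rewrite -val_eqE /= => /negPf ->; rewrite mul0r.
rewrite /lc (bigD1 a) //= [X in _ + X]big1 ?addr0; last first.
  by move=> b /negPf ba; rewrite big1 // => k _; rewrite /expo N0_coef ba mul0n mul0r.
rewrite -[in RHS](pick 0%N) // -(pick (p a)) ?tp_width // -big_split /=.
apply: eq_bigr => k _; rewrite /expo N0_coef eqxx mul1n natz absz_nat natrD mulrDl //.
Qed.

(** Exponentials of a real state evolved in both directions never vanish and solve the T-system, so
    the recurrence of the cosets applies to every initial window. *)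
Lemma Tdatum_periodic : finite_type alpha ->
  exists2 Om, (0 < Om)%N & fwd_periodic W p np nm (@lse R) Om.
Proof.
move=> /(@finite_type_recurrence R _ _ W) [u0 [u1 [u01 H]]].
exists (u1 - u0)%N; first by rewrite subn_gt0.
refine (@solz_recurrence_periodic R r W p np nm (@lse R) (@supported_Nplus)
  (@supported_Nminus) u0 u1 (ltnW u01) _) => f a k kp t.
apply: expR_inj.
have kW : (k < W)%N by apply: ltn_trans kp (tp_width a).
apply: (H (fun a u => expR (t a u)) _ a (Ordinal kW)) => b u; split; first by rewrite gt_eqF ?expR_gt0.
rewrite !Tmon_expR.
- rewrite lc_N0 addr0 -expR_lse; congr expR.
  have := solz_system W (@tp_gt0 _ alpha) (@lse R) (@supported_Nplus) (@supported_Nminus) f b (u - u0%:Z).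
  rewrite /t addrAC => ->; congr lse; apply: eq_bigr => c _; apply: eq_bigr => j _;
    by rewrite addrAC.
- by move=> c; apply/size_supported/supported_Nminus.
- by move=> c; apply/size_supported/supported_Nplus.
- by move=> c; apply: size_N0.
Qed.

Lemma ratr_mxeval1 (N : 'M[{poly int}]_r) : supported p (expo N) ->
  (forall b a (k : nat), 0 <= (N b a)`_k) ->
  map_mx (ratr : rat -> R) (mxeval 1 (N0 alpha - N)) = Amx R W p (expo N).
Proof.
move=> sN N_ge0; apply/matrixP => b a; rewrite !mxE.
rewrite [X in peval 1 X](_ : _ = (N0 alpha - N) b a); last by rewrite !mxE.
have sA : (size ((N0 alpha - N)%R b a) <= W)%N.
  rewrite mxE (leq_trans (size_polyD _ _)) // geq_max size_N0 /= mxE size_polyN.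
  exact: size_supported.
rewrite (peval_sum _ sA) rmorph_sum; apply: eq_bigr => i _ /=.
by rewrite expr1n mulr1 ratr_int A_coef.
Qed.

Lemma ratr_Kcheck : map_mx (ratr : rat -> R) (Kcheck alpha) =
  invmx (diag_mx (\row_a d a)) *m (invmx (Amx R W p np) *m Amx R W p nm) *m diag_mx (\row_a d a).
Proof.
have dE : map_mx (ratr : rat -> R) (intdiag _ (td alpha)) = diag_mx (\row_a d a).
  by apply/matrixP => i j; rewrite !mxE rmorphMn /= ratr_int.
rewrite /Kcheck /Kmx !map_mxM !map_invmx dE.
rewrite (ratr_mxeval1 (@supported_Nplus)); last exact: Nplus_ge0.
rewrite (ratr_mxeval1 (@supported_Nminus)) //; exact: Nminus_ge0.
Qed.

End CartanData.

Theorem theorem5p10 (R : realType) (r : nat) (alpha : Tdatum r)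
    (cartan_alpha : Cartan_like alpha) (finite_alpha : finite_type alpha) :
  [/\ Aplus1 alpha \in unitmx,
      Aminus1 alpha \in unitmx,
      exists! f : 'rV[R]_r, Nahm_solution alpha f
    & forall f : 'rV[R]_r, Nahm_solution alpha f ->
        exists q : rat, c_alpha alpha f = ratr q].
Proof.
have sp := @supported_Nplus _ alpha; have sm := @supported_Nminus _ alpha.
have pW := @tp_width _ alpha; have p0 := @tp_gt0 _ alpha.
have symp := @Tdatum_symplectic_coef _ _ cartan_alpha R.
have [Om Om0 per] := Tdatum_periodic cartan_alpha R finite_alpha.
have [l [l_gt0 lpm]] := simultaneous_positivity p0 sp sm Om0 per.
have lp a := (lpm a).1; have lm a := (lpm a).2.
have d0 a : 0 < (td alpha 0 a)%:~R :> R by rewrite ltr0z td_gt0.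
have nahmE (f : 'rV[R]_r) : Nahm_solution alpha f =
    nahm_system (map_mx (ratr : rat -> R) (Kcheck alpha)) f.
  rewrite /Nahm_solution /nahm_system; congr (_ /\ _).
  by apply/eq_forall => a; congr (_ = _); apply: eq_bigr => b _; rewrite [in RHS]mxE.
split.
(* Invertibility over the rationals is tested after embedding them in R, where the weight l
   lives. *)
- rewrite -(map_unitmx (ratr : {rmorphism rat -> R})) (ratr_mxeval1 cartan_alpha R sp (@Nplus_ge0 _ alpha)).
  exact: (Amx_unit pW l_gt0 lp lm (or_introl erefl)).
- rewrite -(map_unitmx (ratr : {rmorphism rat -> R})) (ratr_mxeval1 cartan_alpha R sm (@Nminus_ge0 _ alpha)).
  exact: (Amx_unit pW l_gt0 lp lm (or_intror erefl)).
- have [f [f_sol f_uniq]] := nahm_system_unique pW d0 symp l_gt0 lp lm.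
  exists f; split=> [|g]; rewrite nahmE ratr_Kcheck //.
  exact: f_uniq.
- move=> f; rewrite nahmE ratr_Kcheck // => /(nahm_systemP pW d0 symp l_gt0 lp lm) [t t_sol ->].
  have [q qE] := rational_dilog_sum p0 pW sp sm (@expo_disjoint _ alpha) Om0 per symp t_sol.
  exists q; rewrite -qE /c_alpha; congr (_ * _); apply: eq_bigr => a _.
  by rewrite mxE.
Qed.
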